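(* Let $L\in[L_0,\infty)\setminus E$. There exists $\delta_1\in(0,\delta_0]$ such that for $|\delta|<\delta_1$ and all $i=1,\dots,n$ the zero-eigenspace of the linearised operator $\mathcal{L}^\delta_i$ at the steady states in $\mathcal{E}^{\delta,i}$ has dimension one, and the zero-eigenspace of $\mathcal{L}^\delta_0$ (the linearisation at the steady state $0$) has dimension zero.
   Context: $\mathbb{T}=\mathbb{R}/L\mathbb{Z}$, $\Delta=\partial_x^2$, $W(v)=\frac14(v^2-1)^2$; $\dot L^2$, $\dot H^k_{per}$ are the zero-mean functions in $L^2(\mathbb{T})$, $H^k(\mathbb{T})$; $(\tau_sv)(x)=v(x+s)$. For a solution $u^*$ of $\delta u u_x+\Delta^2(\Delta u-W'(u))=0$, the linearised operator is $\mathcal{L}^\delta_{u^*}h=\delta(u^*h)_x+\Delta^2(\Delta h-W''(u^* )h)$, with domain $\dot H^6_{per}$ in $\dot L^2$; $\mathcal{L}^\delta_i$ denotes $\mathcal{L}^\delta_{u^*}$ for $u^*\in\mathcal{E}^{\delta,i}$. The constants $L_0$ and $E$: for $c=(c_1,c_2)$ let $P_c(u)=2(W(u)+c_1u+c_2)$; let $\mathcal{C}$ be the set of $(c_1,c_2)$ with $c_2\in(-\frac14,0)$ for which $P_c$ has four distinct real roots $u_1<u_m<0<u_M<u_2$; let $g_1(c)=\int_{u_m}^{u_M}\frac{du}{\sqrt{P_c(u)}}$ on $\mathcal{C}$, and $E=Z\cup\{2k\pi:k\ge1\}$ with $Z$ the (Lebesgue null) set of critical values of $g_1$. $L_0>0$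 is a constant such that for $0<\ell<L_0$ there is no nonconstant zero-mean solution of $\Delta^2(\Delta u-W'(u))=0$ with principal period $\ell$, while for $L\in[L_0,\infty)\setminus E$ nonconstant zero-mean $L$-periodic solutions of this equation exist and form finitely many translation orbits. The families: $\mathcal{E}^{\delta,0}=\{0\}$. Let $u^1,\dots,u^n$ be representatives of these $n$ translation orbits with $u^i(0)=u^i(L)=0$. There are $\delta_0>0$ and $C^1$ maps $(-\delta_0,\delta_0)\ni\delta\mapsto u^{\delta,i}\in\{u\in\dot H^6_{per}:u(0)=u(L)=0\}$ with $u^{0,i}=u^i$, $\delta u^{\delta,i}u^{\delta,i}_x+\Delta^2(\Delta u^{\delta,i}-W'(u^{\delta,i}))=0$ and $\|u^{\delta,i}-u^i\|_{H^6}\le C|\delta|$. Put $\mathcal{E}^{\delta,i}=\{\tau_su^{\delta,i}:s\in[0,L)\}$. *)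

(* Defs.v *)
From HB Require Import structures.
From mathcomp Require Import all_boot all_order all_algebra.
From mathcomp Require Import all_classical all_reals all_analysis.

Set Implicit Arguments.
Unset Strict Implicit.
Unset Printing Implicit Defensive.

Import Order.TTheory GRing.Theory Num.Theory.
Import numFieldTopology.Exports numFieldNormedType.Exports.

Local Open Scope classical_set_scope.
Local Open Scope ring_scope.

(* Functions on the torus R/LZ are represented by L-periodic functions on R. *)
Section Torus.
Variable R : realType.
Implicit Types (f g u v h : R -> R) (L delta s x y : R).

Notation mu := (@lebesgue_measure R).

Definition L2per L f : Prop :=
  [/\ periodic f L, measurable_fun [set: R] f &
      mu.-integrable `[0, L] (fun x => (f x ^+ 2)%:E)].

(* H^k(R/LZ), with each class represented by its continuous representative
   when k >= 1: f, f', ..., f^(k-1) are absolutely continuous, being the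
   primitives of the next derivative, and all derivatives up to order k are
   square integrable.  For j < k the function derive1n j f is a classical
   derivative; derive1n k f is in general one only almost everywhere. *)
Definition Hper L (k : nat) f : Prop :=
  (forall j, (j <= k)%N -> L2per L (derive1n j f)) /\
  (forall j, (j < k)%N -> forall x y, x <= y ->
     derive1n j f y - derive1n j f x =
       \int[mu]_(t in `[x, y]) derive1n j.+1 f t).

Definition Hdot L (k : nat) f : Prop :=
  Hper L k f /\ \int[mu]_(x in `[0, L]) f x = 0.

Definition Hnorm L (k : nat) f : R :=
  Num.sqrt (\sum_(j < k.+1) \int[mu]_(x in `[0, L]) (derive1n j f x ^+ 2)).

Definition shift_by s f : R -> R := fun x => f (x + s).

Definition W (v : R) : R := 4^-1 * (v ^+ 2 - 1) ^+ 2.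

Definition Lap f : R -> R := derive1n 2 f.

Definition steady_op delta u : R -> R := fun x =>
  delta * u x * derive1 u x + Lap (Lap (fun y => Lap u y - derive1 W (u y))) x.

Definition steady L delta u : Prop :=
  Hdot L 6 u /\ {ae mu, forall x, steady_op delta u x = 0}.

Definition lin_op delta (ustar : R -> R) h : R -> R := fun x =>
  delta * derive1 (fun y => ustar y * h y) x
  + Lap (Lap (fun y => Lap h y - derive1n 2 W (ustar y) * h y)) x.

(* The geometric eigenspace of lin_op, with domain Hdot L 6, for the eigenvalue
   lambda; the codomain is written R^o to make it a set of vectors. *)
Definition eigenspace_lin L delta (ustar : R -> R) (lambda : R) :
    set (R -> R^o) :=
  [set h | Hdot L 6 h /\
     {ae mu, forall x, lin_op delta ustar h x = lambda * h x}].

Definition nonconstant f : Prop := ~ exists a, forall x, f x = a.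

Definition principal_period L f : Prop :=
  [/\ 0 < L, periodic f L & forall p, 0 < p < L -> ~ periodic f p].

Definition orbit_of L f : set (R -> R) :=
  [set shift_by s f | s in `[0, L[].

Definition nonconst_steady0 L u : Prop := nonconstant u /\ steady L 0 u.

Definition orbit_representatives L (n : nat) (u : 'I_n -> R -> R) : Prop :=
  [/\ forall i, nonconst_steady0 L (u i),
      forall i j, i != j -> ~ orbit_of L (u i) (u j) &
      forall v, nonconst_steady0 L v -> exists i, orbit_of L (u i) v].

Definition Ppot (c : R * R) (v : R) : R := 2 * (W v + c.1 * v + c.2).

Definition four_roots (c : R * R) (u1 um uM u2 : R) : Prop :=
  [/\ [/\ u1 < um, um < 0, 0 < uM & uM < u2],
      Ppot c u1 = 0, Ppot c um = 0, Ppot c uM = 0 & Ppot c u2 = 0].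

Definition Cset : set (R * R) :=
  [set c : R * R | - 4^-1 < c.2 < 0 /\
     exists u1 um uM u2 : R, four_roots c u1 um uM u2].

(* The pair (u_m, u_M); it is unique when c belongs to Cset. *)
Definition inner_roots (c : R * R) : R * R :=
  xget (0, 0) [set m : R * R | exists u1 u2 : R, four_roots c u1 m.1 m.2 u2].

Definition g1 (c : R * R) : R :=
  \int[mu]_(v in `](inner_roots c).1, (inner_roots c).2[)
     (Num.sqrt (Ppot c v))^-1.

Definition critical_values_g1 : set R :=
  [set g1 c | c in [set c : R * R | Cset c /\ is_diff c g1 (fun=> 0)]].

Definition Eset : set R :=
  critical_values_g1 `|` [set 2 * k%:R * pi | k in [set k : nat | (1 <= k)%N]].

Definition is_L0 (L0 : R) : Prop :=
  [/\ 0 < L0,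
      forall l, 0 < l < L0 ->
        ~ exists u, nonconst_steady0 l u /\ principal_period l u &
      forall L, L0 <= L -> ~ Eset L ->
        exists (n : nat) (u : 'I_n -> R -> R),
          (0 < n)%N /\ orbit_representatives L u].

Definition H6dot_pinned L u : Prop := [/\ Hdot L 6 u, u 0 = 0 & u L = 0].

(* U is a C^1 map from ]- delta0, delta0[ to H6dot_pinned, for the H^6 norm;
   V is its derivative. *)
Definition C1_curve L (delta0 : R) (U : R -> R -> R) : Prop :=
  (forall delta, `|delta| < delta0 -> H6dot_pinned L (U delta)) /\
  exists V : R -> R -> R, forall delta, `|delta| < delta0 ->
    [/\ H6dot_pinned L (V delta),
        Hnorm L 6 (fun x => (U (delta + e) x - U delta x) / e - V delta x)
          @[e --> 0^'] --> (0 : R) &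
        Hnorm L 6 (fun x => V e x - V delta x) @[e --> delta] --> (0 : R)].

Definition continuation_families L (n : nat) (u : 'I_n -> R -> R)
    (delta0 : R) (U : 'I_n -> R -> R -> R) : Prop :=
  [/\ 0 < delta0,
      forall i, C1_curve L delta0 (U i),
      forall i, U i 0 = u i,
      forall i delta, `|delta| < delta0 -> steady L delta (U i delta) &
      exists C : R, forall i delta, `|delta| < delta0 ->
        Hnorm L 6 (fun x => U i delta x - u i x) <= C * `|delta|].

Definition Efam L (n : nat) (U : 'I_n -> R -> R -> R) delta (i : 'I_n) :
    set (R -> R) :=
  orbit_of L (U i delta).

Definition Efam0 : set (R -> R) := [set (fun=> 0)].

End Torus.

(* S is a linear subspace of V with a basis of d elements; V itself need not be
   finite dimensional. *)
Definition has_dim (K : fieldType) (V : lmodType K) (S : set V) (d : nat) :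
    Prop :=
  exists e : 'I_d -> V,
    (forall a : 'I_d -> K,
       \sum_(i < d) a i *: e i = 0 -> forall i, a i = 0) /\
    S = [set \sum_(i < d) a i *: e i | a in [set: 'I_d -> K]].

(* Main.v *)
Require Import Defs.
From mathcomp Require Import all_boot all_order all_algebra.
From mathcomp Require Import all_classical all_reals all_analysis.
From mathcomp Require Import measurable_realfun ring lra.
Import Order.TTheory GRing.Theory Num.Theory.
Import numFieldTopology.Exports numFieldNormedType.Exports.
Local Open Scope classical_set_scope.
Local Open Scope ring_scope.

Set Implicit Arguments.
Unset Strict Implicit.
Unset Printing Implicit Defensive.

(* At delta = 0 a steady state solves u'' = u^3 - u + c, hence
   u'^2 = (u - p) (q - u) Q(u) / 2 with p = min u, q = max u and Q a concave
   quadratic, positive on [p, q].  If p + q > 0 the orbit spends more time above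
   the midpoint than below it and its mean is positive, so zero mean forces
   p + q = 0 and c = 0: u is odd about its zeros, with
   u'^2 = (a - u^2) (2 - a - u^2) / 2, 0 < a < 1.  For such u the operator
   h |-> h'' - (3 u^2 - 1) h is a Lame operator whose kernel and whose inverse
   image of the constants are explicit; it follows that h'' - (3 u^2 - 1) h = k + r
   with h periodic of zero mean and h(0) = 0 forces |h| <= C sup |r|, uniformly
   in the constant k.
   For small delta let v be the steady state near u; v' lies in the kernel of the
   linearisation and v'(0) <> 0.  Subtracting a multiple of v' from a kernel
   element gives one, g, with g(0) = 0.  Integrating its equation four times,
   g'' - (3 v^2 - 1) g is a constant up to O(delta) sup |g|, so
   sup |g| <= C (O(delta) + O(|v - u|)) sup |g|, and g = 0. *)

(** * Derivatives and periodic functions *)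

Section Calculus.
Context {R : realType}.
Implicit Types (f g F G : R -> R) (x y a b c L : R).

Lemma deriv_eq f x a b : is_derive x 1 f a -> a = b -> is_derive x 1 f b.
Proof. by move=> + <-. Qed.

Lemma deriv_cst c x : is_derive x 1 (fun _ : R => c) 0.
Proof. exact: is_derive_cst. Qed.

Lemma deriv_id x : is_derive x 1 (fun y : R => y) 1.
Proof. exact: is_derive_id. Qed.

Lemma deriv_add f g x a b : is_derive x 1 f a -> is_derive x 1 g b ->
  is_derive x 1 (fun y => f y + g y) (a + b).
Proof. by move=> ? ?; exact: is_deriveD. Qed.

Lemma deriv_opp f x a : is_derive x 1 f a -> is_derive x 1 (fun y => - f y) (- a).
Proof. by move=> ?; exact: is_deriveN. Qed.

Lemma deriv_mul f g x a b : is_derive x 1 f a -> is_derive x 1 g b ->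
  is_derive x 1 (fun y => f y * g y) (a * g x + f x * b).
Proof.
move=> df dg; apply: (@deriv_eq _ _ (f x * b + g x * a)); last by ring.
Qed.

Lemma deriv_expn f n x a : is_derive x 1 f a ->
  is_derive x 1 (fun y => f y ^+ n) (n%:R * f x ^+ n.-1 * a).
Proof.
elim: n => [|n IH] df.
  by apply: deriv_eq; [exact: deriv_cst|rewrite !mul0r].
apply: (@deriv_eq _ _ (a * f x ^+ n + f x * (n%:R * f x ^+ n.-1 * a))).
  have -> : (fun y => f y ^+ n.+1) = (fun y => f y * f y ^+ n).
    by apply/funext => y; rewrite exprS.
  exact: deriv_mul df (IH df).
case: n {IH} => [|n] /=; first by rewrite expr0; ring.
by rewrite !exprS -[n.+2%:R]natr1; ring.
Qed.

Lemma deriv_inv f x a : f x != 0 -> is_derive x 1 f a ->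
  is_derive x 1 (fun y => (f y)^-1) (- a / f x ^+ 2).
Proof.
move=> fx0 df; apply: (@deriv_eq _ _ (- (f x ^+ 2)^-1 * a)); last by ring.
Qed.

Lemma deriv_comp f g x a b : is_derive x 1 g b -> is_derive (g x) 1 f a ->
  is_derive x 1 (fun y => f (g y)) (a * b).
Proof. by move=> dg df; exact: is_derive1_comp. Qed.

Lemma deriv_sqrt f x a : 0 < f x -> is_derive x 1 f a ->
  is_derive x 1 (fun y => Num.sqrt (f y)) (a / (2 * Num.sqrt (f x))).
Proof.
move=> fx0 df; have := deriv_comp df (is_derive1_sqrt fx0).
by move/deriv_eq; apply; rewrite mulrC.
Qed.

Lemma deriv_shift f s x a : is_derive (x + s) 1 f a ->
  is_derive x 1 (fun y => f (y + s)) a.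
Proof.
move=> df; have := deriv_comp (deriv_add (deriv_id x) (deriv_cst s x)) df.
by move/deriv_eq; apply; ring.
Qed.

Lemma deriv_continuous f (g : R -> R) : (forall x, is_derive x 1 f (g x)) -> continuous f.
Proof.
move=> df x; apply: differentiable_continuous; apply/derivable1_diffP.
by case: (df x).
Qed.

Lemma derive1_deriv f x a : is_derive x 1 f a -> derive1 f x = a.
Proof. by move=> df; rewrite derive1E derive_val. Qed.

Lemma deriv_derive1 f x : derivable f x 1 -> is_derive x 1 f (derive1 f x).
Proof. by move=> df; rewrite derive1E; exact/derivableP. Qed.

Lemma mean_value f g a b : (forall x, is_derive x 1 f (g x)) -> a < b ->
  exists c, [/\ a < c, c < b & f b - f a = g c * (b - a)].
Proof.
move=> df ab.
have [|c cab ->] := @MVT R f g a b ab _.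
  by apply: continuous_subspaceT; exact: deriv_continuous df.
- by exists c; move: cab; rewrite in_itv/= => /andP[? ?].
Qed.

Lemma mean_value_bound f g a b M : (forall x, is_derive x 1 f (g x)) -> a <= b ->
  (forall x, a <= x <= b -> `|g x| <= M) -> `|f b - f a| <= M * (b - a).
Proof.
move=> df; rewrite le_eqVlt => /predU1P[->|ab] gM.
  by rewrite !subrr normr0 mulr0.
have [c [ac cb ->]] := mean_value df ab.
have ba0 : 0 < b - a by rewrite subr_gt0.
by rewrite normrM (gtr0_norm ba0) ler_pM2r// gM// !ltW.
Qed.

Lemma deriv0_const f : (forall x, is_derive x 1 f 0) -> forall x y, f x = f y.
Proof.
move=> df x y; wlog xy : x y / x <= y.
  by move=> H; case/orP: (le_total x y) => /H // ->.
have : `|f y - f x| <= 0 * (y - x).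
  by apply: (@mean_value_bound f (fun=> 0)) => // ? _; rewrite normr0.
by rewrite mul0r normr_le0 subr_eq0 => /eqP.
Qed.

Lemma periodic_end f L : periodic f L -> f L = f 0.
Proof. by move=> pf; rewrite -[in LHS](add0r L) pf. Qed.

Lemma periodic_critical f g L : 0 < L -> f L = f 0 ->
  (forall x, is_derive x 1 f (g x)) -> exists2 c, 0 <= c <= L & g c = 0.
Proof.
move=> L0 fL df; have [c [c0 cL]] := mean_value df L0.
rewrite fL subrr subr0 => /esym/eqP; rewrite mulf_eq0 (gt_eqF L0) orbF => /eqP gc.
by exists c => //; rewrite !ltW.
Qed.

(** One representative serves all [L]-periodic functions at once, so a relation between several of
    them need only be checked on one period. *)
Lemma periodic_repr L x : 0 < L ->
  exists2 y, 0 <= y < L & forall f, periodic f L -> f x = f y.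
Proof.
move=> L0; have shiftk f : periodic f L -> forall (k : int) z, f (z + L *~ k) = f z.
  move=> pf [] k z; first by rewrite -pmulrn periodicn.
  by rewrite NegzE mulrNz -pmulrn -[in RHS](subrK (L *+ k.+1) z) periodicn.
pose k := Num.floor (x / L).
exists (x - L *~ k); last by move=> f /shiftk/(_ (- k) x) <-; rewrite mulrNz.
have /andP[k1 k2] := real_floor_itv (num_real (x / L)).
rewrite -mulrzl; move: k1 k2; rewrite intrD /= ler_pdivlMr// ltr_pdivrMr//.
by move=> k1 k2; apply/andP; split; lra.
Qed.

Lemma periodic_deriv f g L : periodic f L -> (forall x, is_derive x 1 f (g x)) ->
  periodic g L.
Proof.
move=> pf df x; rewrite -(derive1_deriv (df x)); apply/esym/derive1_deriv.
by rewrite (_ : f = fun y => f (y + L)); [exact: deriv_shift|apply/funext => y; rewrite pf].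
Qed.

Lemma continuous_bounded f a b : continuous f -> a <= b ->
  exists2 M, 0 < M & forall x, a <= x <= b -> `|f x| <= M.
Proof.
move=> cf ab; have cnf : continuous (fun x => `|f x|).
  by move=> x; apply: continuous_comp; [exact: cf|exact: norm_continuous].
have [c _ fc] := EVT_max ab (continuous_subspaceT cnf).
exists (`|f c| + 1); first by rewrite ltr_wpDl.
by move=> x xab; rewrite (le_trans (fc x _))// lerDl.
Qed.

End Calculus.

(** Hypotheses about derivatives take precedence over the structural rules; the value is left to
    unification and normalised afterwards through [deriv_eq]. *)
Ltac deriv_step := first
  [ eassumption
  | match goal with H : forall x, is_derive x 1 _ _ |- _ => eapply H end
  | eapply deriv_cst | eapply deriv_id | eapply deriv_add | eapply deriv_opp
  | eapply deriv_mul | eapply deriv_expn ].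
Ltac deriv_tac := eapply deriv_eq; [repeat deriv_step|].

(** * Primitives *)

Section Integration.
Context {R : realType}.
Implicit Types (f g F G : R -> R) (x y a b c L : R).
Notation mu := (@lebesgue_measure R).

Lemma continuous_integrable f a b : continuous f ->
  mu.-integrable `[a, b] (EFin \o f).
Proof.
move=> cf; apply: continuous_compact_integrable; first exact: segment_compact.
exact: continuous_subspaceT.
Qed.

Lemma exists_primitive f : continuous f ->
  exists F, forall x, is_derive x 1 F (f x).
Proof.
move=> cf.
pose F x := if 0 <= x then \int[mu]_(t in `]0, x]) f t
            else - \int[mu]_(t in `]x, 0]) f t.
exists F => x.
(* The fundamental theorem is applied on an interval starting at [- N], to the left of both [x] and
   [0]; beyond [- N] both branches of [F] are one integral from [- N] minus a constant. *)
pose N : R := `|x| + 1.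
have Nx : - N < x by rewrite ltrNl /N; have := ler_norm (- x); rewrite normrN; lra.
have N0 : - N <= 0 by rewrite oppr_le0 /N addr_ge0.
pose P y := \int[mu]_(t in `[- N, y]) f t - \int[mu]_(t in `[- N, 0]) f t.
have PF y : - N < y -> P y = F y.
  move=> Ny; rewrite /P /F; case: ifPn => [y0|]; last rewrite -ltNge => /ltW y0.
    rewrite Rintegral_itvB ?bnd_simp//.
    exact: continuous_integrable.
  rewrite -[LHS]opprB; congr (- _); rewrite Rintegral_itvB ?bnd_simp//.
  - exact: continuous_integrable.
  - exact: ltW.
have [dP P'] : derivable (fun y => \int[mu]_(t in `[- N, y]) f t) x 1 /\
    derive1 (fun y => \int[mu]_(t in `[- N, y]) f t) x = f x.
  apply: (@continuous_FTC1_closed _ f (- N) x (x + 1)) => //.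
  - by rewrite ltrDl.
  - exact: continuous_integrable.
  - exact: cf.
have dPx : is_derive x 1 P (f x).
  have := deriv_add (deriv_derive1 dP) (deriv_cst (- \int[mu]_(t in `[- N, 0]) f t) x).
  by rewrite P' addr0.
apply: near_eq_is_derive dPx.
near=> y; apply: PF; near: y; exact: lt_nbhsr.
Unshelve. all: by end_near. Qed.

Lemma FTC2 F f a b : (forall x, is_derive x 1 F (f x)) -> continuous f ->
  a <= b -> \int[mu]_(t in `[a, b]) f t = F b - F a.
Proof.
move=> dF cf; rewrite le_eqVlt => /predU1P[->|ab].
  by rewrite set_itv1 Rintegral_set1 subrr.
rewrite /Rintegral (@continuous_FTC2 _ f F) //.
- exact: continuous_subspaceT.
- have cF := deriv_continuous dF; split.
  + by move=> x _; case: (dF x).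
  + exact: (cvg_at_right_filter (cF a)).
  + exact: (cvg_at_left_filter (cF b)).
- by move=> x _; exact: derive1_deriv.
Qed.

End Integration.

(** * Regularity of Sobolev functions *)

Section SobolevRegularity.
Context {R : realType}.
Implicit Types (f g F G : R -> R) (x y a b c L : R).
Notation mu := (@lebesgue_measure R).

(** [|f| <= 1 + f^2], and constants are integrable on a bounded interval. *)
Lemma L2per_integrable L f : L2per L f -> mu.-integrable `[0, L] (EFin \o f).
Proof.
move=> [_ mf f2]; apply: (@le_integrable _ _ _ mu _ _ _ (fun x => (1 + f x ^+ 2)%:E)) => //.
- by apply/measurable_EFinP; exact: measurable_funTS.
- move=> x _ /=; rewrite lee_fin [leRHS]ger0_norm; last by rewrite addr_ge0// sqr_ge0.
  rewrite -real_normK ?num_real//; set t := `|f x|; have := sqr_ge0 (t - 1).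
  by have : 0 <= t := normr_ge0 _; nra.
- apply: (@integrableD _ _ _ mu _ _ (fun=> 1%:E) (fun x => (f x ^+ 2)%:E)) => //.
  by apply: (@continuous_integrable _ (fun=> 1)) => ?; exact: cvg_cst.
Qed.

Lemma shift_continuous c : continuous (fun x : R => x + c).
Proof. by move=> x; apply: cvgD; [exact: cvg_id|exact: cvg_cst]. Qed.

(** At [0] a left neighbourhood is carried by periodicity to a left neighbourhood of [L]; any other
    point is first translated into [[0, L[]. *)
Lemma periodic_continuous L f : 0 < L -> periodic f L ->
  {within `[0, L], continuous f} -> continuous f.
Proof.
move=> L0 pf cf.
have [cin c0 cL] := (continuous_within_itvP f L0).1 cf.
have cf0 y : 0 <= y < L -> {for y, continuous f}.
  move=> /andP[]; rewrite le_eqVlt => /predU1P[<- _|y0 yL]; last first.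
    by apply: cin; rewrite in_itv/= y0 yL.
  apply/cvgrPdist_lt => e e0.
  move/cvgrPdist_lt : c0 => /(_ e e0)[d /= d0 Hd].
  move/cvgrPdist_lt : cL => /(_ e e0)[d' /= d'0 Hd'].
  near=> t.
  have [t0|t0|->] := ltgtP t 0; last by rewrite subrr normr0.
  - rewrite -[f t](pf t) -[f 0](pf 0) add0r; apply: Hd' => /=; last by lra.
    have -> : L - (t + L) = - t by ring.
    by rewrite normrN; near: t; exact: (@cvgr0_norm_lt _ _ _ _ _ id).
  - apply: Hd => //=; rewrite sub0r normrN; near: t; exact: (@cvgr0_norm_lt _ _ _ _ _ id).
move=> x; have [y y0L xy] := periodic_repr x L0.
have -> : f = f \o (fun t => t + (y - x)).
  apply/funext => t /=.
  have -> : t = x + (t - x) by rewrite subrKC.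
  rewrite (xy (fun z => f (z + (t - x)))) => [|z]; last by rewrite addrAC pf.
  by congr f; ring.
apply: continuous_comp; first exact: shift_continuous.
by rewrite subrKC; exact: cf0.
Unshelve. all: by end_near. Qed.

End SobolevRegularity.

Section HperRegularity.
Context {R : realType}.
Implicit Types (f g F G : R -> R) (x y a b c L : R).
Notation mu := (@lebesgue_measure R).

Lemma Hper_periodic L k f j : Hper L k f -> (j <= k)%N -> periodic (derive1n j f) L.
Proof. by move=> [Hf _] /Hf[]. Qed.

(** On [[0, L]] the [j]-th derivative is a constant plus the indefinite integral of an integrable
    function. *)
Lemma Hper_continuous L k f j : 0 < L -> Hper L k f -> (j < k)%N ->
  continuous (derive1n j f).
Proof.
move=> L0 [Hf If] jk; have [pf _ _] := Hf _ (ltnW jk).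
apply: (periodic_continuous L0 pf).
have fint := L2per_integrable (Hf _ jk).
have cI := parameterized_integral_continuous (ltW L0) fint.
have cI' : {within `[0, L], continuous (fun x => parameterized_integral mu 0 x (derive1n j.+1 f) + derive1n j f 0)}.
  by move=> x; apply: cvgD; [exact: cI|exact: cvg_cst].
apply: subspace_eq_continuous cI' => x.
rewrite inE/= in_itv/= => /andP[x0 _].
have := If j jk 0 x x0.
by rewrite /= /from_subspace /parameterized_integral => <-; rewrite subrK.
Qed.

(** Here [derive1n j.+1 f] is continuous, so its integral agrees with a classical primitive. *)
Lemma Hper_deriv L k f j : 0 < L -> Hper L k f -> (j.+1 < k)%N ->
  forall x, is_derive x 1 (derive1n j f) (derive1n j.+1 f x).
Proof.
move=> L0 Hf jk x; have cf := Hper_continuous L0 Hf jk.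
have [P dP] := exists_primitive cf.
have -> : derive1n j f = fun y => P y + (derive1n j f 0 - P 0).
  have ftc a b : a <= b -> derive1n j f b - derive1n j f a = P b - P a.
    by move=> ab; rewrite Hf.2 ?(ltnW jk)// (FTC2 dP cf ab).
  apply/funext => y; case/orP : (le_total 0 y) => /ftc; lra.
by deriv_tac; rewrite addr0.
Qed.

(** Lebesgue differentiation supplies the existence of the derivative almost everywhere; its value
    is then [derive1n k.+1 f] by definition. *)
Lemma Hper_ae_deriv L k f : 0 < L -> Hper L k.+1 f ->
  {ae mu, forall x, 0 < x < L -> is_derive x 1 (derive1n k f) (derive1n k.+1 f x)}.
Proof.
move=> L0 [Hf If]; set g := derive1n k.+1 f.
have gint : mu.-integrable `[0, L] (EFin \o g) := L2per_integrable (Hf _ (leqnn _)).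
have gint' y : mu.-integrable `[0, y] (EFin \o g \_ `[0, L]).
  rewrite -restrict_EFin; apply/integrable_restrict => //=.
  by apply: integrableS gint => //; exact: measurableI.
(* [g] is cut off outside [[0, L]] to be integrable on the whole line; near a point of []0, L[] the
   integrals from [0] do not see the cut. *)
have /(FTC1 gint') : locally_integrable setT (g \_ `[0, L]) by exact: integrable_locally.
apply: filterS; first exact: (ae_filter_ringOfSetsType mu).
move=> x /= Hx /andP[x0 xL].
have [|dI _] := Hx; first by rewrite lte_fin.
suff df : derivable (derive1n k f) x 1 by exact: deriv_derive1.
have [] // : is_derive x 1 (derive1n k f)
    (derive1 (fun x => (\int[mu]_(t in `[0%R, x]) (g \_ `[0%R, L]) t)%R) x + 0).
have := deriv_add (deriv_derive1 dI) (deriv_cst (derive1n k f 0) x).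
apply: near_eq_is_derive; near=> y.
have y0 : 0 < y by near: y; exact: lt_nbhsr.
have yL : y < L by near: y; exact: lt_nbhsl.
rewrite (_ : \int[mu]_(t in `[0, y]) (g \_ `[0, L]) t = \int[mu]_(t in `[0, y]) g t).
  by rewrite -If ?subrK// ltW.
apply: eq_Rintegral => t; rewrite inE/= in_itv/= => /andP[t0 ty].
by rewrite patchE mem_set//= in_itv/= t0 (le_trans ty (ltW yL)).
Unshelve. all: by end_near. Qed.

(* A primitive of g and the k-th derivative of f differ by a constant on one
   period; both are periodic, so they differ by a constant everywhere. *)
Lemma Hper_deriv_ae_eq L k f g : 0 < L -> Hper L k.+1 f ->
  continuous g -> periodic g L ->
  {ae mu, forall x, 0 < x < L -> derive1n k.+1 f x = g x} ->
  forall x, is_derive x 1 (derive1n k f) (g x).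
Proof.
move=> L0 [Hf If] cg pg aeg; have [G dG] := exists_primitive cg.
have fG y : 0 <= y <= L -> derive1n k f y = G y + (derive1n k f 0 - G 0).
  move=> /andP[y0 yL]; suff : derive1n k f y - derive1n k f 0 = G y - G 0 by lra.
  rewrite If// -(FTC2 dG cg y0) /Rintegral; congr fine.
  have [_ mf _] := Hf _ (leqnn k.+1).
  apply: ae_eq_integral => //.
  - by apply/measurable_EFinP; exact: measurable_funTS.
  - by apply/measurable_EFinP/measurable_funTS; exact: continuous_measurable_fun.
  (* The identity is known on the open interval only, so the end points [0] and [y] are discarded as
     null sets. *)
  have aeN c : {ae mu, forall x, x != c}.
    exists [set c]; split=> //; first exact: lebesgue_measure_set1.
    by move=> x /= /negP; rewrite negbK => /eqP.
  apply: (@filterS3 _ _ (ae_filter_ringOfSetsType mu) _ _ _ _ _ aeg (aeN 0) (aeN y)) => x /= fg x0 xy.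
  rewrite in_itv/= => /andP[x0' xy']; rewrite fg//.
  by rewrite lt_def x0 x0' /= (lt_le_trans _ yL)// lt_neqAle xy.
have pG : periodic G L.
  have fL := fG L; have f0 : derive1n k f L = derive1n k f 0.
    by have [pf _ _] := Hf _ (leqnSn k); rewrite -[in LHS](add0r L) pf.
  move=> x; have dGL (t : R) : is_derive t 1 (fun t => G (t + L) - G t) 0.
    by apply: deriv_eq (deriv_add (deriv_shift (dG _)) (deriv_opp (dG _))) _; rewrite pg subrr.
  have := deriv0_const dGL x 0; rewrite add0r.
  by have := fG L; rewrite (ltW L0) lexx f0 => /(_ isT); lra.
have -> : derive1n k f = fun y => G y + (derive1n k f 0 - G 0).
  apply/funext => y; have [z /andP[z0 zL] yz] := periodic_repr y L0.
  have [pf _ _] := Hf _ (leqnSn k).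
  by rewrite (yz _ pf) (yz _ pG) fG// z0 ltW.
by move=> x; deriv_tac; rewrite addr0.
Qed.

(** [H (t + L) - H t] is constant in [t], and at [t = 0] it is the integral of [h] over a period. *)
Lemma Hdot_primitive L k h : 0 < L -> Hdot L k.+1 h ->
  exists2 H, periodic H L & forall x, is_derive x 1 H (h x).
Proof.
move=> L0 [Hh h0]; have ch : continuous h := Hper_continuous (j := 0) L0 Hh (ltn0Sn _).
have [H dH] := exists_primitive ch; exists H => //.
have ph : periodic h L := Hper_periodic (j := 0) Hh (leq0n _).
move=> x; have dHL (t : R) : is_derive t 1 (fun t => H (t + L) - H t) 0.
  by apply: deriv_eq (deriv_add (deriv_shift (dH _)) (deriv_opp (dH _))) _; rewrite ph subrr.
have := deriv0_const dHL x 0; rewrite add0r.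
by move: h0; rewrite (FTC2 dH ch (ltW L0)); lra.
Qed.

End HperRegularity.

(** * Functions of class C^n *)

Section Smoothness.
Context {R : realType}.
Implicit Types (f g F G : R -> R) (x y a b c L : R).
Notation mu := (@lebesgue_measure R).

Fixpoint Cn n f : Prop :=
  if n is m.+1 then (forall x, derivable f x 1) /\ Cn m (derive1 f)
  else continuous f.

Lemma Cn_continuous n f : Cn n f -> continuous f.
Proof.
case: n => [//|n [df _]].
by apply: (@deriv_continuous _ _ (derive1 f)) => x; exact: deriv_derive1.
Qed.

Lemma Cn_pred n f : Cn n.+1 f -> Cn n f.
Proof.
elim: n f => [|n IH] f; first exact: Cn_continuous.
by move=> [df /IH].
Qed.

Lemma Cn_le m n f : (m <= n)%N -> Cn n f -> Cn m f.
Proof.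
elim: n m => [|n IH] m; first by rewrite leqn0 => /eqP->.
by rewrite leq_eqVlt => /predU1P[->//|mn /Cn_pred]; exact: IH.
Qed.

Lemma CnS n f g : (forall x, is_derive x 1 f (g x)) -> Cn n g -> Cn n.+1 f.
Proof.
move=> df cg; split; first by move=> x; case: (df x).
by have -> : derive1 f = g by apply/funext => x; exact: derive1_deriv.
Qed.

Lemma Cn_derivS n f : Cn n.+1 f -> forall x, is_derive x 1 f (derive1 f x).
Proof. by move=> [df _] x; exact: deriv_derive1. Qed.

Lemma Cn_derive1n n m f : Cn (m + n) f -> Cn n (derive1n m f).
Proof. by elim: m f => [//|m IH] f [_ /IH]; rewrite -derive1Sn. Qed.

Lemma Cn_deriv n j f : Cn n f -> (j < n)%N ->
  forall x, is_derive x 1 (derive1n j f) (derive1n j.+1 f x).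
Proof.
move=> cf jn; apply: (@Cn_derivS 0); apply: Cn_derive1n.
by apply: Cn_le cf; rewrite addn1.
Qed.

Lemma CnI n f : (forall j x, (j < n)%N -> is_derive x 1 (derive1n j f) (derive1n j.+1 f x)) ->
  continuous (derive1n n f) -> Cn n f.
Proof.
elim: n f => [//|n IH] f df cf; split; first by move=> x; case: (df 0%N x (ltn0Sn _)).
apply: IH; last by rewrite -derive1Sn.
by move=> j x jn; rewrite -!derive1Sn; exact: df.
Qed.

Lemma Cn_cst n c : Cn n (fun=> c).
Proof.
elim: n c => [|n IH] c; first by move=> ?; exact: cvg_cst.
exact: CnS (deriv_cst c) (IH 0).
Qed.

Lemma Cn_add n f g : Cn n f -> Cn n g -> Cn n (fun x => f x + g x).
Proof.
elim: n f g => [|n IH] f g; first by move=> cf cg x; apply: cvgD; [exact: cf|exact: cg].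
move=> cf cg; apply: (@CnS _ _ (fun x => derive1 f x + derive1 g x)).
  by move=> x; exact: deriv_add (Cn_derivS cf x) (Cn_derivS cg x).
by apply: IH; [exact: cf.2|exact: cg.2].
Qed.

Lemma Cn_mul n f g : Cn n f -> Cn n g -> Cn n (fun x => f x * g x).
Proof.
elim: n f g => [|n IH] f g; first by move=> cf cg x; apply: cvgM; [exact: cf|exact: cg].
move=> cf cg; apply: (@CnS _ _ (fun x => derive1 f x * g x + f x * derive1 g x)).
  by move=> x; exact: deriv_mul (Cn_derivS cf x) (Cn_derivS cg x).
apply: Cn_add; apply: IH; [exact: cf.2|exact: Cn_pred|exact: Cn_pred|exact: cg.2].
Qed.

Lemma Cn_opp n f : Cn n f -> Cn n (fun x => - f x).
Proof.
move=> cf; have := Cn_mul (Cn_cst n (- 1)) cf.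
by under eq_fun do rewrite mulN1r.
Qed.

Lemma Cn_exp n f k : Cn n f -> Cn n (fun x => f x ^+ k).
Proof.
move=> cf; elim: k => [|k IH]; first exact: Cn_cst.
by under eq_fun do rewrite exprS; exact: Cn_mul.
Qed.

Lemma derive1n_add n f g : Cn n f -> Cn n g ->
  derive1n n (fun x => f x + g x) = fun x => derive1n n f x + derive1n n g x.
Proof.
elim: n f g => [//|n IH] f g cf cg; rewrite !derive1Sn -(IH _ _ cf.2 cg.2).
congr derive1n; apply/funext => x; apply: derive1_deriv.
exact: deriv_add (Cn_derivS cf x) (Cn_derivS cg x).
Qed.

Lemma derive1n_scale n c f : Cn n f ->
  derive1n n (fun x => c * f x) = fun x => c * derive1n n f x.
Proof.
elim: n f => [//|n IH] f cf; rewrite !derive1Sn -(IH _ cf.2).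
congr derive1n; apply/funext => x; apply: derive1_deriv.
by apply: deriv_eq (deriv_mul (deriv_cst c x) (Cn_derivS cf x)) _; rewrite mul0r add0r.
Qed.

Lemma derive1n_opp n f : Cn n f ->
  derive1n n (fun x => - f x) = fun x => - derive1n n f x.
Proof.
move=> cf; have := derive1n_scale (- 1) cf.
by under eq_fun do rewrite mulN1r; move=> ->; apply/funext => x; rewrite mulN1r.
Qed.

Lemma derive1n_periodic n f L : Cn n f -> periodic f L -> forall j, (j <= n)%N ->
  periodic (derive1n j f) L.
Proof.
move=> cf pf; elim=> [//|j IH] jn.
exact: periodic_deriv (IH (ltnW jn)) (Cn_deriv cf jn).
Qed.

Lemma derive1n_shift n s f : derive1n n (shift_by s f) = shift_by s (derive1n n f).
Proof.
elim: n f => [//|n IH] f; rewrite !derive1Sn -IH; congr derive1n.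
apply/funext => x; rewrite /derive1.
suff -> : (fun h : R => h^-1 *: (shift_by s f (h + x) - shift_by s f x)) =
    (fun h => h^-1 *: (f (h + (x + s)) - f (x + s))) by [].
by apply/funext => h; rewrite /shift_by addrA.
Qed.

Lemma Cn_shift n s f : Cn n f -> Cn n (shift_by s f).
Proof.
elim: n f => [|n IH] f cf.
  move=> x; have h1 := @shift_continuous R s x; have h2 := cf (x + s).
  exact: (continuous_comp h1 h2).
apply: (@CnS _ _ (shift_by s (derive1 f))); last by apply: IH; case: cf.
by move=> x; exact: deriv_shift (Cn_derivS cf _).
Qed.

Lemma periodic_shift s f L : periodic f L -> periodic (shift_by s f) L.
Proof. by move=> pf x; rewrite /shift_by addrAC pf. Qed.

Lemma derive1_W : derive1 (@W R) = fun v => v ^+ 3 - v.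
Proof.
apply/funext => v; apply: derive1_deriv; rewrite /W.
by eapply deriv_eq; [repeat deriv_step|rewrite /=; field].
Qed.

Lemma derive1n2_W : derive1n 2 (@W R) = fun v => 3 * v ^+ 2 - 1.
Proof.
rewrite derive1nS derive1n1 derive1_W; apply/funext => v; apply: derive1_deriv.
by eapply deriv_eq; [repeat deriv_step|rewrite /=; ring].
Qed.

Lemma Cn_Hdot L n h H : 0 < L -> Cn n h -> periodic H L -> (forall x, is_derive x 1 H (h x)) ->
  Hdot L n h.
Proof.
move=> L0 ch pH dH.
have ph := periodic_deriv pH dH.
have cD j : (j <= n)%N -> continuous (derive1n j h).
  move=> jn; apply: (@Cn_continuous 0); apply: Cn_derive1n; rewrite addn0.
  exact: Cn_le ch.
split; last first.
  rewrite (FTC2 dH (cD 0%N (leq0n _)) (ltW L0)) -[in H L](add0r L) pH.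
  exact: subrr.
split=> [j jn|j jn x y xy]; last by rewrite (FTC2 (Cn_deriv ch jn) (cD _ jn) xy).
split; first exact: derive1n_periodic ch ph _ jn.
- exact: continuous_measurable_fun (cD _ jn).
- apply: (@continuous_integrable _ (fun x => derive1n j h x ^+ 2)).
  by apply: (@Cn_exp 0); exact: cD.
Qed.

(** Stated at a single point, because in [bootstrap] the role of [g] is played by a fifth derivative
    that is at first differentiable only almost everywhere. *)
Lemma derive1nS_sub k f g h x a : Cn k.+1 h ->
  derive1n k f = (fun y => g y - derive1n k h y) -> is_derive x 1 g a ->
  derive1n k.+1 f x = a - derive1n k.+1 h x.
Proof.
move=> ch E dg; rewrite derive1nS E; apply: derive1_deriv.
exact: deriv_add dg (deriv_opp (Cn_deriv ch (ltnSn k) x)).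
Qed.

(* Where the fifth derivative of f is not differentiable, [derive1n 6 f] and the
   fourth derivative in the equation are junk values; this happens on a null set
   only, so f^(6) agrees a.e. with the C^1 function M'''' - B. *)
Lemma bootstrap L f M B : 0 < L -> Hper L 6 f -> Cn 5 M -> periodic M L ->
  Cn 1 B -> periodic B L ->
  {ae mu, forall x, B x + derive1n 4 (fun y => derive1n 2 f y - M y) x = 0} ->
  Cn 7 f /\ forall x, B x + derive1n 4 (fun y => derive1n 2 f y - M y) x = 0.
Proof.
move=> L0 Hf cM pM cB pB aeE.
have c5 : Cn 5 f.
  apply: CnI => [j x j5|]; first exact: Hper_deriv L0 Hf _ x.
  exact: Hper_continuous L0 Hf _.
have D3 : derive1n 3 (fun y => derive1n 2 f y - M y) = fun y => derive1n 5 f y - derive1n 3 M y.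
  rewrite derive1n_add; last 2 first.
  - exact: (@Cn_derive1n 3 2).
  - by apply: Cn_opp; exact: Cn_le cM.
  by rewrite derive1n_opp//; exact: Cn_le cM.
have D4 x : is_derive x 1 (derive1n 5 f) (derive1n 6 f x) ->
    derive1n 4 (fun y => derive1n 2 f y - M y) x = derive1n 6 f x - derive1n 4 M x.
  by move=> df; exact: derive1nS_sub (Cn_le _ cM) D3 df.
have aux (p q r : R) : p + (q - r) = 0 -> q = r - p by lra.
pose g x := derive1n 4 M x - B x.
have cg : Cn 1 g.
  exact: Cn_add (@Cn_derive1n 1 4 M cM) (Cn_opp cB).
have pg : periodic g L.
  by move=> x; rewrite /g pB (derive1n_periodic cM pM).
have df5 : forall x, is_derive x 1 (derive1n 5 f) (g x).
  apply: (Hper_deriv_ae_eq L0 Hf (Cn_continuous cg) pg).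
  apply: (@filterS2 _ _ (ae_filter_ringOfSetsType mu) _ _ _ _ aeE (Hper_ae_deriv L0 Hf)).
  move=> x E df x0L.
  exact: aux (etrans (congr1 (fun t => B x + t) (esym (D4 x (df x0L)))) E).
have gE : derive1n 6 f = g.
  by apply/funext => x; rewrite derive1nS; exact: derive1_deriv.
have gE7 : derive1n 7 f = derive1 g by rewrite -gE -derive1nS.
(* The seventh derivative is what later places [derive1 u], for a steady state [u], in [Cn 6]. *)
have c7 : Cn 7 f.
  apply: CnI => [j x|].
    rewrite ltnS leq_eqVlt => /predU1P[->|]; first by rewrite gE7 gE; exact: Cn_derivS cg x.
    rewrite ltnS leq_eqVlt => /predU1P[->|j5]; first by rewrite gE.
    exact: Cn_deriv c5 j5 x.
  by rewrite gE7; case: cg.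
split=> // x; rewrite (D4 x (@Cn_deriv 7 5 f c7 isT x)) gE /g.
by rewrite addrAC subrr sub0r addrN.
Qed.

End Smoothness.

(** * The linearised operator on smooth functions *)

Section ClassicalKernel.
Context {R : realType}.
Implicit Types (f g F G u v h : R -> R) (x y a b c L delta : R).
Notation mu := (@lebesgue_measure R).

Lemma Hper_Cn L k f : 0 < L -> Hper L k.+1 f -> Cn k f.
Proof.
move=> L0 Hf; apply: CnI => [j x jk|]; first exact: Hper_deriv L0 Hf jk x.
exact: Hper_continuous L0 Hf (ltnSn k).
Qed.

(** The linearised chemical potential, with [3 v^2 - 1 = W''(v)]; its fourth derivative is the part
    of the linearisation that survives at [delta = 0]. *)
Definition flux v h : R -> R :=
  fun y => derive1n 2 h y - (3 * v y ^+ 2 - 1) * h y.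

Lemma lin_opE delta v h x : lin_op delta v h x =
  delta * derive1 (fun y => v y * h y) x + derive1n 4 (flux v h) x.
Proof. by rewrite /lin_op derive1n2_W. Qed.

Lemma steady_opE delta u x : steady_op delta u x =
  delta * u x * derive1 u x +
  derive1n 4 (fun y => derive1n 2 u y - (u y ^+ 3 - u y)) x.
Proof. by rewrite /steady_op derive1_W. Qed.

(* For a continuous periodic h, this says that h has integral 0 over a period. *)
Definition has_zero_mean L h :=
  exists2 H, periodic H L & forall x, is_derive x 1 H (h x).

Definition ker_lin L delta v h :=
  [/\ Cn 6 h, has_zero_mean L h & forall x, lin_op delta v h x = 0].

Lemma zero_mean_periodic L h : has_zero_mean L h -> periodic h L.
Proof. by move=> [H pH dH]; exact: periodic_deriv pH dH. Qed.

Lemma Cn_potential n v : Cn n v -> Cn n (fun y => 3 * v y ^+ 2 - 1).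
Proof.
move=> cv; apply: Cn_add; last exact: Cn_cst.
by apply: Cn_mul; [exact: Cn_cst|exact: Cn_exp].
Qed.

Lemma Cn_flux n v h : Cn n v -> Cn n.+2 h -> Cn n (flux v h).
Proof.
move=> cv ch; apply: Cn_add; first exact: (@Cn_derive1n _ n 2).
apply: Cn_opp; apply: Cn_mul; first exact: Cn_potential.
exact: Cn_pred (Cn_pred ch).
Qed.

Lemma periodic_potential L v h : periodic v L -> periodic h L ->
  periodic (fun y => (3 * v y ^+ 2 - 1) * h y) L.
Proof. by move=> pv ph x; rewrite pv ph. Qed.

(** [bootstrap] with [M = W''(v) h] and [B = delta (v h)'] makes the equation classical, after which
    the eigenspace is studied without measure theory. *)
Lemma eigenspace_linE L delta v h : 0 < L -> Cn 5 v -> periodic v L ->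
  eigenspace_lin L delta v 0 h <-> ker_lin L delta v h.
Proof.
move=> L0 cv pv; split=> [[Hh aeE]|[ch [H pH dH] E]]; last first.
  split; first exact: Cn_Hdot L0 ch pH dH.
  by apply: aeW => x; rewrite E mul0r.
have zh := Hdot_primitive L0 Hh.
have c5 : Cn 5 h := Hper_Cn L0 Hh.1.
have ph : periodic h L by exact: zero_mean_periodic zh.
have cM : Cn 5 (fun y => (3 * v y ^+ 2 - 1) * h y) := Cn_mul (Cn_potential cv) c5.
have cvh : Cn 5 (fun y => v y * h y) := Cn_mul cv c5.
have pvh : periodic (fun y => v y * h y) L by move=> x; rewrite pv ph.
have cB : Cn 1 (fun x => delta * derive1 (fun y => v y * h y) x).
  by apply: Cn_mul; [exact: Cn_cst|exact: (@Cn_le _ 1 4 _ isT cvh.2)].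
have pB : periodic (fun x => delta * derive1 (fun y => v y * h y) x) L.
  by move=> x; rewrite (periodic_deriv pvh (Cn_derivS cvh)).
have [|c7 E] := bootstrap L0 Hh.1 cM (periodic_potential pv ph) cB pB.
  apply: filterS aeE; first exact: (ae_filter_ringOfSetsType mu).
  by move=> x; rewrite lin_opE mul0r.
split; [exact: Cn_pred c7|exact: zh|].
by move=> x; rewrite lin_opE; exact: E.
Qed.

(** [bootstrap] with [M = W'(u)] and [B = delta u u']. *)
Lemma steady_classical L delta u : 0 < L -> steady L delta u ->
  [/\ Cn 7 u, has_zero_mean L u & forall x, steady_op delta u x = 0].
Proof.
move=> L0 [Hu aeE].
have zu := Hdot_primitive L0 Hu.
have c5 : Cn 5 u := Hper_Cn L0 Hu.1.
have pu : periodic u L by exact: zero_mean_periodic zu.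
have cM : Cn 5 (fun y => u y ^+ 3 - u y) := Cn_add (Cn_exp 3 c5) (Cn_opp c5).
have pM : periodic (fun y => u y ^+ 3 - u y) L by move=> x; rewrite pu.
have cB : Cn 1 (fun x => delta * u x * derive1 u x).
  apply: Cn_mul; last by exact: (@Cn_le _ 1 4 _ isT c5.2).
  by apply: Cn_mul; [exact: Cn_cst|exact: (@Cn_le _ 1 5 _ isT c5)].
have pB : periodic (fun x => delta * u x * derive1 u x) L.
  by move=> x; rewrite pu (periodic_deriv pu (Cn_derivS c5)).
have [|c7 E] := bootstrap L0 Hu.1 cM pM cB pB.
  apply: filterS aeE; first exact: (ae_filter_ringOfSetsType mu).
  by move=> x; rewrite steady_opE.
by split; [exact: c7|exact: zu|move=> x; rewrite steady_opE; exact: E].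
Qed.

(* Differentiate the steady equation in x. *)
Lemma ker_lin_derive1 L delta u : Cn 7 u -> has_zero_mean L u ->
  (forall x, steady_op delta u x = 0) -> ker_lin L delta u (derive1 u).
Proof.
move=> c7 zu E.
have du := Cn_derivS c7; have ddu := @Cn_derivS _ 5 (derive1 u) c7.2.
split; first exact: c7.2.
  by exists u => //; exact: zero_mean_periodic zu.
move=> x; rewrite lin_opE.
pose F y := derive1n 2 u y - (u y ^+ 3 - u y).
have c5 : Cn 5 u := @Cn_le _ 5 7 u isT c7.
have cF : Cn 5 F := Cn_add (@Cn_derive1n _ 5 2 u c7) (Cn_opp (Cn_add (Cn_exp 3 c5) (Cn_opp c5))).
have F' : derive1 F = flux u (derive1 u).
  apply/funext => y; rewrite /flux; apply: derive1_deriv.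
  have dF := deriv_add (@Cn_deriv _ 7 2 u c7 isT y)
    (deriv_opp (deriv_add (deriv_expn 3 (du y)) (deriv_opp (du y)))).
  apply: (deriv_eq dF).
  rewrite -[derive1n 2 (derive1 u) y]/(derive1n 3 u y).
  by move: (derive1n 3 u y) (derive1 u y) => p q /=; ring.
rewrite -F' -derive1Sn derive1nS.
have dF4 := @Cn_deriv _ 5 4 F cF isT x.
have d1 := deriv_mul (du x) (ddu x).
have d2 := deriv_add (deriv_mul (deriv_cst delta x) d1) dF4.
have : is_derive x 1 (fun=> 0 : R) (0 * (u x * derive1 u x) + delta * (derive1 u x * derive1 u x + u x * derive1 (derive1 u) x) + derive1n 5 F x).
  suff <- : (fun y => delta * (u y * derive1 u y) + derive1n 4 F y) = fun=> 0 by [].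
  by apply/funext => y; rewrite mulrA -steady_opE.
move=> /derive1_deriv; rewrite (derive1_deriv (deriv_cst 0 x)) mul0r add0r => ->.
by rewrite (derive1_deriv d1) -derive1nS.
Qed.

Lemma ker_lin_sub L delta v h g c : Cn 5 v -> ker_lin L delta v h -> ker_lin L delta v g ->
  ker_lin L delta v (fun x => h x - c * g x).
Proof.
move=> cv [ch [H pH dH] Eh] [cg [G pG dG] Eg].
have ccg := Cn_mul (Cn_cst 6 c) cg.
split; first exact: Cn_add ch (Cn_opp ccg).
  exists (fun x => H x - c * G x); first by move=> x; rewrite pH pG.
  move=> x; apply: deriv_eq (deriv_add (dH x) (deriv_opp (deriv_mul (deriv_cst c x) (dG x)))) _.
  by rewrite mul0r add0r.
move=> x.
have c6 (k : R -> R) : Cn 6 k -> Cn 2 k by exact: (@Cn_le _ 2 6 k isT).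
have cF k : Cn 6 k -> Cn 4 (flux v k).
  by move=> ck; apply: Cn_flux => //; exact: (@Cn_le _ 4 5 v isT cv).
have FE : flux v (fun x => h x - c * g x) = fun y => flux v h y + (- c) * flux v g y.
  apply/funext => y; rewrite /flux.
  rewrite (derive1n_add (c6 _ ch) (Cn_opp (c6 _ ccg))).
  rewrite (derive1n_opp (c6 _ ccg)) (derive1n_scale c (c6 _ cg)).
  by move: (derive1n 2 h y) (derive1n 2 g y) => p q; ring.
have Fx : derive1n 4 (flux v (fun x => h x - c * g x)) x =
    derive1n 4 (flux v h) x + (- c) * derive1n 4 (flux v g) x.
  rewrite FE (derive1n_add (cF _ ch) (Cn_mul (Cn_cst 4 (- c)) (cF _ cg))).
  by rewrite (derive1n_scale (- c) (cF _ cg)).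
have dv := Cn_derivS cv x; have dh := Cn_derivS ch x; have dg := Cn_derivS cg x.
have dvh := deriv_mul dv dh; have dvg := deriv_mul dv dg.
have dvhg := deriv_mul dv (deriv_add dh (deriv_opp (deriv_mul (deriv_cst c x) dg))).
have := Eh x; have := Eg x; rewrite !lin_opE.
rewrite (derive1_deriv dvh) (derive1_deriv dvg) (derive1_deriv dvhg).
rewrite {}Fx; move: (derive1n 4 (flux v h) x) (derive1n 4 (flux v g) x) => p q E1 E2.
move: (derive1 v x) (derive1 h x) (derive1 g x) E1 E2 => v1 h1 g1 E1 E2.
have -> : q = - (delta * (v1 * g x + v x * g1)) by lra.
have -> : p = - (delta * (v1 * h x + v x * h1)) by lra.
by ring.
Qed.

Lemma ker_lin_shift L delta s v h : ker_lin L delta v h ->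
  ker_lin L delta (shift_by s v) (shift_by s h).
Proof.
move=> [ch [H pH dH] E]; split; first exact: Cn_shift.
  exists (shift_by s H); first exact: periodic_shift.
  by move=> x; apply: deriv_shift.
move=> x; rewrite -(E (x + s)) !lin_opE.
have e1 := derive1n_shift 1 s (fun y => v y * h y).
have -> : flux (shift_by s v) (shift_by s h) = shift_by s (flux v h).
  by apply/funext => y; rewrite /flux derive1n_shift.
rewrite derive1n_shift.
congr (delta * _ + _); exact: (congr1 (fun F => F x) e1).
Qed.

(** By Rolle's theorem [g] has a zero in the period, and no point of the period is farther than [L]
    from it. *)
Lemma critical_bound L f g g' M : 0 < L -> f L = f 0 ->
  (forall x, is_derive x 1 f (g x)) -> (forall x, is_derive x 1 g (g' x)) ->
  (forall x, 0 <= x <= L -> `|g' x| <= M) -> forall x, 0 <= x <= L -> `|g x| <= M * L.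
Proof.
move=> L0 fL df dg gM x /andP[x0 xL].
have [c /andP[c0 cL] gc] := periodic_critical L0 fL df.
have M0 : 0 <= M by apply: le_trans (gM 0 _); rewrite ?normr_ge0// lexx ltW.
have [xc|cx] := leP x c.
  have : `|g c - g x| <= M * (c - x).
    apply: mean_value_bound => // y /andP[y0 yc]; apply: gM.
    by rewrite (le_trans x0 y0) (le_trans yc cL).
  by rewrite gc sub0r normrN => /le_trans; apply; rewrite ler_wpM2l//; lra.
have : `|g x - g c| <= M * (x - c).
  apply: mean_value_bound => // [|y /andP[y0 yc]]; first exact: ltW.
  by apply: gM; rewrite (le_trans c0 y0) (le_trans yc xL).
by rewrite gc subr0 => /le_trans; apply; rewrite ler_wpM2l//; lra.
Qed.

(** With [F = flux v h] the equation integrates to [F''' + delta v h = const]. Since [F'''] has a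
    zero, it is at most [2 |delta| M]; the three further integrations, down to [F - F 0], cost a
    factor [L] each. *)
Lemma ker_lin_estimate L delta v h M : 0 < L -> Cn 5 v -> periodic v L ->
  ker_lin L delta v h -> (forall x, `|v x * h x| <= M) ->
  exists k, forall x, 0 <= x <= L ->
    `|flux v h x - k| <= 2 * `|delta| * M * L ^+ 3.
Proof.
move=> L0 cv pv [ch zh E] vhM.
pose F := flux v h.
have cF : Cn 4 F by apply: Cn_flux => //; exact: (@Cn_le _ 4 5 v isT cv).
have ph := zero_mean_periodic zh.
have pF : periodic F L.
  by move=> x; rewrite /F /flux (derive1n_periodic ch ph (isT : (2 <= 6)%N)) pv ph.
have per j : (j <= 4)%N -> derive1n j F L = derive1n j F 0.
  by move=> j4; rewrite -[in LHS](add0r L) (derive1n_periodic cF pF j4).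
have d0 := @Cn_deriv _ 4 0 F cF isT; have d1 := @Cn_deriv _ 4 1 F cF isT.
have d2 := @Cn_deriv _ 4 2 F cF isT; have d3 := @Cn_deriv _ 4 3 F cF isT.
have dvh x := deriv_mul (Cn_derivS cv x) (Cn_derivS ch x).
have d3c x : is_derive x 1 (fun y => derive1n 3 F y + delta * (v y * h y)) 0.
  apply: deriv_eq (deriv_add (d3 x) (deriv_mul (deriv_cst delta x) (dvh x))) _.
  by rewrite -[RHS](E x) lin_opE (derive1_deriv (dvh x)) mul0r add0r addrC.
have L00 : 0 <= (0 : R) <= L by rewrite lexx ltW.
have [c c0L F3c] := periodic_critical L0 (per 2%N isT) d2.
have B3 x : 0 <= x <= L -> `|derive1n 3 F x| <= 2 * `|delta| * M.
  move=> _; have := deriv0_const d3c x c; rewrite F3c add0r.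
  move: (derive1n 3 F x) => p pE.
  have -> : p = delta * (v c * h c) - delta * (v x * h x) by rewrite -pE addrK.
  rewrite (le_trans (ler_normB _ _))// !normrM.
  have := ler_wpM2l (normr_ge0 delta) (vhM c); have := ler_wpM2l (normr_ge0 delta) (vhM x).
  by rewrite !normrM; lra.
have B2 := critical_bound L0 (per 1%N isT) d1 d2 B3.
have B1 := critical_bound L0 (per 0%N isT) d0 d1 B2.
exists (F 0) => x /andP[x0 xL].
have := mean_value_bound d0 x0 (fun y => _).
move=> /(_ (2 * `|delta| * M * L * L)) H.
apply: le_trans (H _) _.
  by move=> y /andP[y0 yx]; apply: B1; rewrite y0 (le_trans yx).
have M0 : 0 <= M by apply: le_trans (vhM 0); exact: normr_ge0.
rewrite subr0 !exprS expr0 mulr1 -!mulrA.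
by do 3 (apply: ler_wpM2l => //); do 2 (apply: ler_wpM2l; first exact: ltW).
Qed.

End ClassicalKernel.

(** * Steady states at delta = 0 *)

Section Elliptic.
Context {R : realType}.
Implicit Types (f g F G u v h w : R -> R) (x y a b c d p q L : R).

(** [w] is nonnegative by the bound itself; [w expR (K x)] is nondecreasing and [w expR (- K x)]
    nonincreasing, which settles the two sides of [x0]. *)
Lemma gronwall_zero w w1 K x0 : (forall x, is_derive x 1 w (w1 x)) ->
  (forall x, `|w1 x| <= K * w x) -> 0 < K -> w x0 = 0 -> forall x, w x = 0.
Proof.
move=> dw wK K0 wx0 x.
have w0 y : 0 <= w y by have := le_trans (normr_ge0 _) (wK y); rewrite pmulr_rge0.
have dexp (k y : R) : is_derive y 1 (fun t => expR (k * t)) (expR (k * y) * k).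
  have := deriv_comp (deriv_mul (deriv_cst k y) (deriv_id y)) (is_derive_expR (k * y)).
  by move/deriv_eq; apply; ring.
apply/eqP; rewrite eq_le w0 andbT; have [xx0|x0x] := leP x x0.
- move: xx0; rewrite [x <= x0]le_eqVlt => /predU1P[->|xx0]; first by rewrite wx0.
  have dg y := deriv_mul (dw y) (dexp K y).
  have [c [_ _ E]] := mean_value dg xx0.
  have : 0 <= w x0 * expR (K * x0) - w x * expR (K * x).
    rewrite E; apply: mulr_ge0; last by rewrite subr_ge0 ltW.
    have := wK c; rewrite ler_norml => /andP[h1 _].
    have -> : w1 c * expR (K * c) + w c * (expR (K * c) * K) = (w1 c + K * w c) * expR (K * c) by ring.
    by rewrite mulr_ge0// ?expR_ge0//; lra.
  by rewrite wx0 mul0r sub0r oppr_ge0 pmulr_lle0// expR_gt0.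
have dg y := deriv_mul (dw y) (dexp (- K) y).
have [c [_ _ E]] := mean_value dg x0x.
have : w x * expR (- K * x) - w x0 * expR (- K * x0) <= 0.
  rewrite E; apply: mulr_le0_ge0; last by rewrite subr_ge0 ltW.
  have := wK c; rewrite ler_norml => /andP[_ h1].
  have -> : w1 c * expR (- K * c) + w c * (expR (- K * c) * - K) = - ((K * w c - w1 c) * expR (- K * c)) by ring.
  by rewrite oppr_le0 mulr_ge0// ?expR_ge0//; lra.
by rewrite wx0 mul0r subr0 pmulr_lle0// expR_gt0.
Qed.

(* The quadratic factor left when the roots p and q are removed from the
   quartic, which has no cubic term: u'^2 = (u - p) (q - u) Q(u) / 2. *)
Definition cofactor p q c := 2 - p ^+ 2 - q ^+ 2 - p * q - (p + q) * c - c ^+ 2.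

(** If [Q q <= 0], the energy identity bounds [|u'|] by a multiple of [q - u]; this difference
    vanishes at [xM], hence everywhere by Gronwall, although [u] takes the value [p < q]. *)
Lemma cofactor_max_gt0 u u1 p q xM : (forall x, is_derive x 1 u (u1 x)) ->
  (forall x, u1 x ^+ 2 = 2^-1 * ((u x - p) * (q - u x) * cofactor p q (u x))) ->
  (forall x, p <= u x <= q) -> u xM = q -> p < q -> (exists x, u x = p) ->
  0 < cofactor p q q.
Proof.
move=> du en pq uM ltpq [xm um]; rewrite ltNge; apply/negP => Q0.
(* [Q t - Q q = (q - t) (p + 2 q + t)], whose last factor is at most [2 |p| + 3 |q|] for [t <= q].
   The added [1] gives [K <= K^2]. *)
pose K := 1 + (q - p) * (2 * `|p| + 3 * `|q|).
have K1 : 1 <= K by rewrite lerDl mulr_ge0// ?subr_ge0 ?ltW// addr_ge0// mulr_ge0.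
have dw x : is_derive x 1 (fun y => q - u y) (- u1 x).
  by apply: deriv_eq (deriv_add (deriv_cst q x) (deriv_opp (du x))) _; rewrite add0r.
suff /(gronwall_zero dw) : forall x, `|- u1 x| <= K * (q - u x).
  move=> /(_ xM (lt_le_trans ltr01 K1)); rewrite uM subrr => /(_ erefl xm).
  by rewrite um; lra.
move=> x; have Kw0 : 0 <= K * (q - u x).
  by apply: mulr_ge0; [lra|rewrite subr_ge0; case/andP: (pq x)].
rewrite normrN -(ger0_norm Kw0) -ler_sqr ?nnegrE// !real_normK ?num_real//.
rewrite en; have /andP[pu uq] := pq x.
have pn : - `|p| <= p by have := ler_norm (- p); rewrite normrN; lra.
have qn : - `|q| <= q by have := ler_norm (- q); rewrite normrN; lra.
have pn' := ler_norm p; have qn' := ler_norm q.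
pose S := 2 * `|p| + 3 * `|q|.
have S0 : 0 <= S by rewrite addr_ge0// mulr_ge0.
have cofE : cofactor p q (u x) <= (q - u x) * S.
  have -> : cofactor p q (u x) = cofactor p q q + (q - u x) * (p + 2 * q + u x).
    by rewrite /cofactor; ring.
  have : (q - u x) * (p + 2 * q + u x) <= (q - u x) * S by apply: ler_wpM2l; rewrite /S; lra.
  by lra.
have : (u x - p) * (q - u x) * cofactor p q (u x) <= (q - p) * (q - u x) * ((q - u x) * S).
  apply: (@le_trans _ _ ((u x - p) * (q - u x) * ((q - u x) * S))).
    by apply: ler_wpM2l => //; apply: mulr_ge0; lra.
  by apply: ler_wpM2r; [apply: mulr_ge0 => //; lra|apply: ler_wpM2r; lra].
have : (q - p) * (q - u x) * ((q - u x) * S) <= (K * (q - u x)) ^+ 2.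
  have -> : (q - p) * (q - u x) * ((q - u x) * S) = ((q - p) * S) * (q - u x) ^+ 2 by ring.
  rewrite exprMn; apply: ler_wpM2r; first exact: sqr_ge0.
  have : 0 <= (q - p) * S by apply: mulr_ge0 => //; lra.
  by rewrite /K -/S; nra.
have : 0 <= (K * (q - u x)) ^+ 2 by exact: sqr_ge0.
by lra.
Qed.


(** [Q] has leading coefficient [-1], so on [[p, q]] it is its chord plus [(c - p) (q - c)]. *)
Lemma cofactor_gt0 p q c : p < q -> 0 < cofactor p q p -> 0 < cofactor p q q ->
  p <= c <= q -> 0 < cofactor p q c.
Proof.
move=> pq Qp Qq /andP[pc cq]; have qp0 : 0 < q - p by lra.
rewrite -(pmulr_rgt0 _ qp0).
have -> : (q - p) * cofactor p q c = (q - c) * cofactor p q p +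
    (c - p) * cofactor p q q + (q - p) * ((c - p) * (q - c)) by rewrite /cofactor; ring.
have t1 : 0 <= (q - p) * ((c - p) * (q - c)) by do 2 (apply: mulr_ge0; [lra|]); lra.
have t2 : 0 <= (q - c) * cofactor p q p by apply: mulr_ge0; lra.
have t3 : 0 <= (c - p) * cofactor p q q by apply: mulr_ge0; lra.
have [cp|cp] := ltP p c.
  have : 0 < (c - p) * cofactor p q q by apply: mulr_gt0; lra.
  by lra.
have : 0 < (q - c) * cofactor p q p by apply: mulr_gt0; lra.
by lra.
Qed.

(* With v = u - (p + q)/2 and Z = u' / sqrt (Q u), one has Z' = - v sqrt (Q u) / 2
   and 2 Z^2 = (u - p) (q - u), so every function of Z is a periodic primitive.
   Choosing the one with derivative 1 / sqrt (2 Z^2 + kappa) in Z, where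
   2 Z^2 + kappa = k - v^2 is the even part of Q in v, the sum
   u + 2 (g (Z))' = (p + q)/2 + v (1 - sqrt (Q u / (k - v^2))) is positive. *)
Lemma zero_mean_midpoint_le0 L u u1 U p q : 0 < L -> periodic u L ->
  (forall x, is_derive x 1 u (u1 x)) ->
  (forall x, is_derive x 1 u1 (u x ^+ 3 - u x - 4^-1 * ((p + q) * (p ^+ 2 + q ^+ 2 - 2)))) ->
  (forall x, u1 x ^+ 2 = 2^-1 * ((u x - p) * (q - u x) * cofactor p q (u x))) ->
  (forall x, p <= u x <= q) -> p < q ->
  0 < cofactor p q p -> 0 < cofactor p q q ->
  periodic U L -> (forall x, is_derive x 1 U (u x)) -> p + q <= 0.
Proof.
move=> L0 pu du ddu en upq ltpq Qp Qq pU dU; rewrite leNgt; apply/negP => m0.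
pose m : R := (p + q) / 2.
(* The value [k2 - ((q - p) / 2)^2] of the even part of [Q] at the two ends, written through [Q q]
   so that its positivity for [m > 0] is visible. *)
pose kappa : R := cofactor p q q + 2 * m * (q - p).
have kappa0 : 0 < kappa by rewrite ltr_pwDl// mulr_ge0// ?subr_ge0 ?ltW// /m; lra.
have Qu x : 0 < cofactor p q (u x) by exact: cofactor_gt0.
pose s x : R := Num.sqrt (cofactor p q (u x)).
have s0 x : 0 < s x by rewrite sqrtr_gt0.
have s2 x : s x ^+ 2 = cofactor p q (u x) by rewrite sqr_sqrtr// ltW.
have dQ x : is_derive x 1 (fun y => cofactor p q (u y)) (- (p + q + 2 * u x) * u1 x).
  rewrite /cofactor; have d := du x.
  by eapply deriv_eq; [repeat deriv_step|rewrite /=; ring].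
have ds x : is_derive x 1 s (- (p + q + 2 * u x) * u1 x / (2 * s x)).
  exact: deriv_sqrt (dQ x).
pose Z x : R := u1 x / s x.
have dZ x : is_derive x 1 Z (- (2^-1 * ((u x - m) * s x))).
  have sx0 : s x != 0 by rewrite gt_eqF.
  apply: deriv_eq (deriv_mul (ddu x) (deriv_inv sx0 (ds x))) _.
  apply: (mulIf (expf_neq0 3 sx0)).
  transitivity ((u x ^+ 3 - u x - 4^-1 * ((p + q) * (p ^+ 2 + q ^+ 2 - 2))) * s x ^+ 2 + 2^-1 * (p + q + 2 * u x) * u1 x ^+ 2); first by field.
  rewrite en [in RHS](_ : - _ * _ = - (2^-1 * (u x - m)) * (s x ^+ 2) ^+ 2); last by ring.
  by rewrite s2 /cofactor /m; field.
have Z2 x : 2 * Z x ^+ 2 = (u x - p) * (q - u x).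
  rewrite /Z expr_div_n s2 en; field.
  by rewrite gt_eqF//; exact: Qu.
pose k2 : R := kappa + ((q - p) / 2) ^+ 2.
have Zk x : 2 * Z x ^+ 2 + kappa = k2 - (u x - m) ^+ 2 by rewrite Z2 /k2 /m; field.
have wpos (z : R) : 0 < 2 * z ^+ 2 + kappa by rewrite ltr_wpDl// mulr_ge0// sqr_ge0.
pose om (z : R) : R := (Num.sqrt (2 * z ^+ 2 + kappa))^-1.
have com : continuous om.
  have dom (z : R) : exists d, is_derive z 1 om d.
    have dz := deriv_add (deriv_mul (deriv_cst 2 z) (deriv_expn 2 (deriv_id z))) (deriv_cst kappa z).
    have sz0 : Num.sqrt (2 * z ^+ 2 + kappa) != 0 by rewrite gt_eqF// sqrtr_gt0.
    have dr := @deriv_sqrt _ (fun t => 2 * t ^+ 2 + kappa) _ _ (wpos z) dz.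
    by eexists; exact: (@deriv_inv _ (fun t => Num.sqrt (2 * t ^+ 2 + kappa)) _ _ sz0 dr).
  apply: (@deriv_continuous _ _ (derive1 om)) => z.
  by have [d dz] := dom z; apply: deriv_derive1; case: dz.
have [G dG] := exists_primitive com.
have dN x : is_derive x 1 (fun y => U y + 2 * G (Z y))
    (u x - (u x - m) * s x * om (Z x)).
  apply: deriv_eq (deriv_add (dU x) (deriv_mul (deriv_cst 2 x) (deriv_comp (dZ x) (dG _)))) _.
  by field.
have pu1 := periodic_deriv pu du.
(* At a critical point of this periodic function the derivative, multiplied by [D], is
   [m D + v (D - s)], where [v (D - s) >= 0] because [(D - s) (D + s) = 4 m v]. This is positive, a
   contradiction. *)
have [|c _] := periodic_critical L0 _ dN.
  by rewrite /Z /s (periodic_end pU) (periodic_end pu) (periodic_end pu1).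
set D := Num.sqrt (2 * Z c ^+ 2 + kappa).
have D0 : 0 < D by rewrite sqrtr_gt0.
have D2 : D ^+ 2 = k2 - (u c - m) ^+ 2 by rewrite -Zk sqr_sqrtr// ltW.
have Ds : D ^+ 2 - s c ^+ 2 = 4 * m * (u c - m).
  by rewrite D2 s2 /k2 /kappa /cofactor /m; field.
have mpos : 0 < m by rewrite /m; lra.
suff : 0 < (u c - (u c - m) * s c * om (Z c)) * D by move=> /[swap] ->; rewrite mul0r ltxx.
have -> : (u c - (u c - m) * s c * om (Z c)) * D = m * D + (u c - m) * (D - s c).
  by rewrite /om -/D; field; rewrite gt_eqF.
rewrite ltr_pwDl ?mulr_gt0// -(pmulr_lge0 _ (_ : 0 < D + s c)) ?addr_gt0//.
have -> : (u c - m) * (D - s c) * (D + s c) = (u c - m) * (D ^+ 2 - s c ^+ 2) by ring.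
rewrite Ds; have -> : (u c - m) * (4 * m * (u c - m)) = 4 * m * (u c - m) ^+ 2 by ring.
by rewrite mulr_ge0 ?sqr_ge0// mulr_ge0// ltW.
Qed.

End Elliptic.

(** * Amplitude and symmetry of zero-mean steady states *)

Section SteadyStates.
Context {R : realType}.
Implicit Types (f g F G u v h w : R -> R) (x y a b c d p q L : R).

Lemma periodic_max L u u1 : 0 < L -> periodic u L ->
  (forall x, is_derive x 1 u (u1 x)) ->
  exists c, (forall x, u x <= u c) /\ u1 c = 0.
Proof.
move=> L0 pu du; have cu := deriv_continuous du.
have [c _ cmax] := EVT_max (ltW L0) (continuous_subspaceT cu).
have umax x : u x <= u c.
  have [y /andP[y0 yL] ->//] := periodic_repr x L0.
  by apply: cmax; rewrite in_itv/= y0 ltW.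
exists c; split => //.
have : is_derive c 1 u 0.
  apply: (@derive1_at_max _ u (c - 1) (c + 1)) => //.
  - by lra.
  - by rewrite in_itv/=; apply/andP; split; lra.
by move/derive1_deriv => <-; rewrite (derive1_deriv (du c)).
Qed.

(** The energy is the same at the minimum [p] and the maximum [q], which determines [c1] and factors
    [u'^2]. The midpoint inequality for [u] and for [- u] gives [p + q = 0]; then [a = q^2], and
    [a < 1] because [Q q = 2 - 2 a] is positive. *)
Lemma steady_amplitude L u u1 U c1 : 0 < L -> periodic u L ->
  (forall x, is_derive x 1 u (u1 x)) ->
  (forall x, is_derive x 1 u1 (u x ^+ 3 - u x + c1)) ->
  periodic U L -> (forall x, is_derive x 1 U (u x)) -> nonconstant u ->
  c1 = 0 /\ exists a, [/\ 0 < a, a < 1, forall x, u x ^+ 2 <= a &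
    forall x, u1 x ^+ 2 = 2^-1 * ((a - u x ^+ 2) * (2 - a - u x ^+ 2))].
Proof.
move=> L0 pu du ddu pU dU ncu.
have dNu x := deriv_opp (du x); have dNu1 x := deriv_opp (ddu x).
have pNu : periodic (fun x => - u x) L by move=> x; rewrite pu.
have [xq [uq u1q]] := periodic_max L0 pu du.
have [xp [up u1p]] := periodic_max L0 pNu dNu.
pose q := u xq; pose p := u xp.
have {}up x : p <= u x by have := up x; rewrite lerN2.
have {}u1p : u1 xp = 0 by apply/eqP; rewrite -oppr_eq0 u1p.
have upq x : p <= u x <= q by rewrite up uq.
have ltpq : p < q.
  have [//|qp] := ltP p q; exfalso; apply: ncu; exists p => x.
  by apply/eqP; rewrite eq_le up andbT (le_trans (uq x)).
have dE x : is_derive x 1 (fun y => u1 y ^+ 2 - 2^-1 * (u y ^+ 2 - 1) ^+ 2 - 2 * c1 * u y) 0.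
  have d1 := du x; have d2 := ddu x.
  by eapply deriv_eq; [repeat deriv_step|rewrite /=; field].
have En x y := deriv0_const dE x y.
have Epq := En xp xq; rewrite u1p u1q -/p -/q in Epq.
have c1E : c1 = - 4^-1 * ((p + q) * (p ^+ 2 + q ^+ 2 - 2)).
  have qp0 : q - p != 0 by rewrite subr_eq0 gt_eqF.
  apply: (mulIf qp0).
  have -> : - 4^-1 * ((p + q) * (p ^+ 2 + q ^+ 2 - 2)) * (q - p) =
    2^-1 * (2^-1 * (p ^+ 2 - 1) ^+ 2 - 2^-1 * (q ^+ 2 - 1) ^+ 2) by field.
  by have -> : c1 * (q - p) = 2^-1 * (2 * c1 * q - 2 * c1 * p) by [field]; lra.
have en x : u1 x ^+ 2 = 2^-1 * ((u x - p) * (q - u x) * cofactor p q (u x)).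
  have := En x xp; rewrite u1p -/p c1E => E.
  have -> : u1 x ^+ 2 = 0 ^+ 2 - 2^-1 * (p ^+ 2 - 1) ^+ 2 -
     2 * (- 4^-1 * ((p + q) * (p ^+ 2 + q ^+ 2 - 2))) * p + 2^-1 * (u x ^+ 2 - 1) ^+ 2 +
     2 * (- 4^-1 * ((p + q) * (p ^+ 2 + q ^+ 2 - 2))) * u x by lra.
  by rewrite /cofactor; field.
have Nen x : (- u1 x) ^+ 2 = 2^-1 * ((- u x - - q) * (- p - - u x) * cofactor (- q) (- p) (- u x)).
  by rewrite sqrrN en /cofactor; field.
have Nupq x : - q <= - u x <= - p by rewrite !lerN2 andbC.
have Nltpq : - q < - p by rewrite ltrN2.
have Qq : 0 < cofactor p q q.
  by apply: (cofactor_max_gt0 du en upq (xM := xq)) => //; exists xp.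
have NQq : 0 < cofactor (- q) (- p) (- p).
  by apply: (cofactor_max_gt0 dNu Nen Nupq (xM := xp)) => //; exists xq.
have cofN c : cofactor (- q) (- p) (- c) = cofactor p q c by rewrite /cofactor; ring.
have Qp : 0 < cofactor p q p by rewrite -cofN.
have pq0 : p + q = 0.
  apply/eqP; rewrite eq_le; apply/andP; split.
    apply: (zero_mean_midpoint_le0 L0 pu du _ en upq ltpq Qp Qq pU dU) => x.
    by apply: deriv_eq (ddu x) _; rewrite c1E; ring.
  (* [- u] solves the same equation with [- c1] in place of [c1], and its extremes are [- q] and
     [- p]. *)
  have pNU : periodic (fun x => - U x) L by move=> x; rewrite pU.
  have := @zero_mean_midpoint_le0 _ L (fun x => - u x) (fun x => - u1 x) (fun x => - U x) (- q) (- p)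
    L0 pNu dNu _ Nen Nupq Nltpq.
  rewrite !cofN => /(_ _ Qq Qp pNU (fun x => deriv_opp (dU x))) H.
  suff : - q - p <= 0 by lra.
  by apply: H => x; apply: deriv_eq (dNu1 x) _; rewrite c1E; ring.
have pE : p = - q by lra.
have q0 : 0 < q by lra.
split; first by rewrite c1E pE; ring.
exists (q ^+ 2); split.
- by rewrite exprn_gt0.
- by have := Qq; rewrite /cofactor pE; nra.
- by move=> x; have /andP[] := upq x; rewrite pE; nra.
- by move=> x; rewrite en /cofactor pE; field.
Qed.

End SteadyStates.

(** * An explicit inverse estimate for the Lame operator *)

Section Nondegeneracy.
Context {R : realType}.
Implicit Types (x y mu eps L : R).

(* For Lh = h'' - (3 u^2 - 1) h, with e = a (2 - a) and b = (1 - a)^2: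
   L u' = 0, L ((1 - u^2) / b) = 1, and psi = (Phi - e x) u' + (2 - e) u - u^3,
   Phi' = u^2, is a second solution of L psi = 0.  It is not periodic:
   psi (x + L) = psi x + (Phi L - e L) u' x, where Phi L <= a L < e L. *)
Lemma nondegenerate L (u u1 : R -> R) a : 0 < L -> periodic u L -> u 0 = 0 ->
  (forall x, is_derive x 1 u (u1 x)) ->
  (forall x, is_derive x 1 u1 (u x ^+ 3 - u x)) ->
  0 < a -> a < 1 -> (forall x, u x ^+ 2 <= a) ->
  (forall x, u1 x ^+ 2 = 2^-1 * ((a - u x ^+ 2) * (2 - a - u x ^+ 2))) ->
  exists2 C, 0 < C & forall (h h1 h2 H : R -> R) mu eps,
    (forall x, is_derive x 1 h (h1 x)) -> (forall x, is_derive x 1 h1 (h2 x)) ->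
    periodic H L -> (forall x, is_derive x 1 H (h x)) -> h 0 = 0 ->
    (forall x, 0 <= x <= L -> `|h2 x - (3 * u x ^+ 2 - 1) * h x - mu| <= eps) ->
    forall x, 0 <= x <= L -> `|h x| <= C * eps.
Proof.
move=> L0 pu u00 du ddu a0 a1 ua en.
pose e : R := a * (2 - a); pose b : R := (1 - a) ^+ 2.
have b0 : 0 < b by rewrite exprn_gt0// subr_gt0.
have bN0 : b != 0 by rewrite gt_eqF.
have cu := deriv_continuous du.
have [Phi Phi0 dPhi] : exists2 Phi : R -> R, Phi 0 = 0 & forall x, is_derive x 1 Phi (u x ^+ 2).
  have cu2 : continuous (fun x => u x ^+ 2).
    apply: (@deriv_continuous _ _ (fun x => 2%:R * u x ^+ 1 * u1 x)) => x.
    exact: deriv_expn (du x).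
  have [P dP] := exists_primitive cu2; exists (fun x => P x - P 0); first by rewrite subrr.
  by move=> x; apply: deriv_eq (deriv_add (dP x) (deriv_cst (- P 0) x)) _; rewrite addr0.
pose psi x := (Phi x - e * x) * u1 x + (2 - e) * u x - u x ^+ 3.
pose psi1 x := (Phi x - e * x) * (u x ^+ 3 - u x) + (2 - 2 * e - 2 * u x ^+ 2) * u1 x.
have dpsi x : is_derive x 1 psi (psi1 x).
  rewrite /psi /psi1; have d1 := du x; have d2 := ddu x; have d3 := dPhi x.
  by eapply deriv_eq; [repeat deriv_step|rewrite /=; ring].
have dpsi1 x : is_derive x 1 psi1 ((3 * u x ^+ 2 - 1) * psi x).
  rewrite /psi1; have d1 := du x; have d2 := ddu x; have d3 := dPhi x.
  eapply deriv_eq; [repeat deriv_step|rewrite /=].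
  transitivity ((3 * u x ^+ 2 - 1) * (Phi x - e * x) * u1 x +
     2 * (u x ^+ 2 - e) * (u x ^+ 3 - u x) + (2 - 2 * e - 2 * u x ^+ 2) * (u x ^+ 3 - u x) -
      4 * u x * u1 x ^+ 2 - (u x ^+ 2 - e) * (u x ^+ 3 - u x)); first by ring.
  by rewrite en /psi /e; field.
pose chi x := (1 - u x ^+ 2) / b.
pose chi1 x := - 2 * u x * u1 x / b.
have dchi x : is_derive x 1 chi (chi1 x).
  rewrite /chi /chi1; have d1 := du x.
  by eapply deriv_eq; [repeat deriv_step|rewrite /=; ring].
have dchi1 x : is_derive x 1 chi1 ((3 * u x ^+ 2 - 1) * chi x + 1).
  rewrite /chi1; have d1 := du x; have d2 := ddu x.
  eapply deriv_eq; [repeat deriv_step|rewrite /=].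
  transitivity (- 2 * (u1 x ^+ 2 + u x * (u x ^+ 3 - u x)) / b); first by ring.
  by rewrite en /chi /b; field; rewrite subr_eq0 gt_eqF.
have [M M0 [uM psiM]] : exists2 M, 0 < M & (forall x, 0 <= x <= L -> `|u1 x| <= M) /\
    (forall x, 0 <= x <= L -> `|psi x| <= M).
  have [M1 M10 uM1] := continuous_bounded (deriv_continuous ddu) (ltW L0).
  have [M2 M20 uM2] := continuous_bounded (deriv_continuous dpsi) (ltW L0).
  exists (M1 + M2); first exact: addr_gt0.
  split=> x xL; [have := uM1 x xL|have := uM2 x xL]; lra.
have dphi1 x : is_derive x 1 (fun y => u y ^+ 3 - u y) ((3 * u x ^+ 2 - 1) * u1 x).
  have d1 := du x.
  by eapply deriv_eq; [repeat deriv_step|rewrite /=; ring].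
(* The constant Wronskian of [u1] and [psi]: at [0] it is [(2 - 2 e) (u1 0)^2] with
   [(u1 0)^2 = e / 2], and [b = 1 - e]. *)
pose w0 := b * e.
have e0 : 0 < e by rewrite mulr_gt0// subr_gt0; lra.
have w00 : 0 < w0 by exact: mulr_gt0.
have wronskian x : u1 x * psi1 x - (u x ^+ 3 - u x) * psi x = w0.
  have dw y : is_derive y 1 (fun x => u1 x * psi1 x - (u x ^+ 3 - u x) * psi x) 0.
    apply: deriv_eq (deriv_add (deriv_mul (ddu y) (dpsi1 y)) (deriv_opp (deriv_mul (dphi1 y) (dpsi y)))) _.
    by ring.
  rewrite (deriv0_const dw x 0) /psi1 /psi u00 Phi0.
  transitivity ((2 - 2 * e) * u1 0 ^+ 2); first by ring.
  by rewrite en u00 /w0 /b /e; field.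
have L00 : 0 <= (0 : R) <= L by rewrite lexx ltW.
have LL : 0 <= L <= L by rewrite lexx ltW.
have PhiL : Phi L <= a * L.
  have [c [_ _]] := mean_value dPhi L0; rewrite Phi0 !subr0 => ->.
  by apply: ler_wpM2r => //; exact: ltW.
pose kappa := e * L - Phi L.
pose k0 := a * (1 - a) * L.
have k00 : 0 < k0 by rewrite !mulr_gt0// subr_gt0.
have k0kappa : k0 <= kappa.
  have : e * L = a * L + k0 by rewrite /e /k0; ring.
  by rewrite /kappa; lra.
(* In units of [eps], [B1] bounds [beta], [B2] the derivative of [N], and [B3] the constant [mu];
   [C] collects the resulting bound on [h]. *)
pose B1 := M * L / k0 + M * L.
have B10 : 0 < B1 by rewrite addr_gt0// ?divr_gt0// mulr_gt0.
pose B2 := (M * L * M + B1 * M) / w0.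
have B20 : 0 < B2 by rewrite divr_gt0// addr_gt0// !mulr_gt0.
pose B3 := B2 * b / (1 - a).
have B30 : 0 < B3 by rewrite divr_gt0// ?subr_gt0// mulr_gt0.
pose C := B3 / b + ((2 * M * B3 + M * L) * M + B1 * M) / w0.
have C0 : 0 < C.
  apply: addr_gt0; apply: divr_gt0 => //; apply: addr_gt0; apply: mulr_gt0 => //.
  by apply: addr_gt0; apply: mulr_gt0 => //; apply: mulr_gt0.
have le_mul (s t s' t' : R) : `|s| <= s' -> `|t| <= t' -> `|s * t| <= s' * t'.
  by move=> ? ?; rewrite normrM ler_pM.
exists C => // h h1 h2 H mu eps dh dh1 pH dH h00 heps.
have eps0 : 0 <= eps by exact: le_trans (normr_ge0 _) (heps _ L00).
(* As [chi] is sent to [1], subtracting [mu chi] leaves a function whose image is the small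
   remainder [r]. *)
pose p x := h x - mu * chi x; pose p1 x := h1 x - mu * chi1 x.
pose r x := h2 x - (3 * u x ^+ 2 - 1) * h x - mu.
have dp x : is_derive x 1 p (p1 x).
  by apply: deriv_eq (deriv_add (dh x) (deriv_opp (deriv_mul (deriv_cst mu x) (dchi x)))) _; rewrite /p1; ring.
have dp1 x : is_derive x 1 p1 ((3 * u x ^+ 2 - 1) * p x + r x).
  apply: deriv_eq (deriv_add (dh1 x) (deriv_opp (deriv_mul (deriv_cst mu x) (dchi1 x)))) _.
  by rewrite /p /r; ring.
(* Variation of constants: up to the factor [w0], [alpha] and [beta] are the coefficients of [p]
   along [u1] and [psi], and their derivatives involve only [r]. *)
pose alpha x := p x * psi1 x - p1 x * psi x.
pose beta x := u1 x * p1 x - (u x ^+ 3 - u x) * p x.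
have dalpha x : is_derive x 1 alpha (- (r x * psi x)).
  apply: deriv_eq (deriv_add (deriv_mul (dp x) (dpsi1 x)) (deriv_opp (deriv_mul (dp1 x) (dpsi x)))) _.
  by ring.
have dbeta x : is_derive x 1 beta (r x * u1 x).
  apply: deriv_eq (deriv_add (deriv_mul (ddu x) (dp1 x)) (deriv_opp (deriv_mul (dphi1 x) (dp x)))) _.
  by ring.
have pE x : p x = (alpha x * u1 x + beta x * psi x) / w0.
  apply: (mulIf (lt0r_neq0 w00)); rewrite divfK ?lt0r_neq0// -(wronskian x).
  by rewrite /alpha /beta; ring.
have alphaB x : 0 <= x <= L -> `|alpha x - alpha 0| <= eps * (M * L).
  move=> /andP[x0 xL].
  apply: le_trans (mean_value_bound (M := eps * M) dalpha x0 _) _.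
    by move=> y /andP[y0 yx]; rewrite normrN le_mul ?heps ?psiM ?y0 ?(le_trans yx).
  by rewrite subr0 mulrA ler_wpM2l// mulr_ge0// ltW.
have betaB x : 0 <= x <= L -> `|beta x - beta 0| <= eps * (M * L).
  move=> /andP[x0 xL].
  apply: le_trans (mean_value_bound (M := eps * M) dbeta x0 _) _.
    by move=> y /andP[y0 yx]; rewrite le_mul ?heps ?uM ?y0 ?(le_trans yx).
  by rewrite subr0 mulrA ler_wpM2l// mulr_ge0// ltW.
have pu1 := periodic_deriv pu du.
have uL : u L = 0 by rewrite (periodic_end pu).
have u1L : u1 L = u1 0 by rewrite (periodic_end pu1).
have ph := periodic_deriv pH dH; have ph1 := periodic_deriv ph dh.
have pL : p L = p 0 by rewrite /p /chi uL u00 (periodic_end ph).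
have p1L : p1 L = p1 0 by rewrite /p1 /chi1 uL u00 u1L (periodic_end ph1).
(* [p] is periodic while [psi] gains [- kappa u1] over a period; since [kappa >= k0 > 0], the small
   variation of [alpha] controls [beta 0]. *)
have alphaL : alpha L - alpha 0 = kappa * beta 0.
  rewrite /alpha /beta pL p1L /psi /psi1 uL u1L u00 Phi0 /kappa; ring.
have beta0 : `|beta 0| <= eps * (M * L / k0).
  have := alphaB L LL; rewrite alphaL normrM (gtr0_norm (lt_le_trans k00 k0kappa)) => kb.
  rewrite mulrA ler_pdivlMr// mulrC; apply: le_trans kb.
  by rewrite ler_wpM2r.
have betaB1 x : 0 <= x <= L -> `|beta x| <= eps * B1.
  move=> xL; rewrite -[beta x](subrK (beta 0)) (le_trans (ler_normD _ _))//.
  by have := betaB x xL; rewrite /B1 mulrDr; lra.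
(* A primitive of [h - mu chi - (alpha 0 / w0) u1], which is [O(eps)]. As [H] and [u] are periodic,
   [N L - N 0] is [- mu (L - Phi L) / b], and [L - Phi L >= (1 - a) L] bounds [mu]: the zero mean of
   [h] enters here. *)
pose N x := H x - mu * ((x - Phi x) / b) - alpha 0 / w0 * u x.
have dN x : is_derive x 1 N (((alpha x - alpha 0) * u1 x + beta x * psi x) / w0).
  have d1 := dH x; have d2 := dPhi x; have d3 := du x; rewrite /N.
  eapply deriv_eq; [repeat deriv_step|rewrite /=].
  have -> : h x = p x + mu * chi x by rewrite /p subrK.
  by rewrite pE /chi; field; rewrite bN0 lt0r_neq0.
have NB x : 0 <= x <= L -> `|((alpha x - alpha 0) * u1 x + beta x * psi x) / w0| <= eps * B2.
  move=> xL; have iw0 : 0 <= w0^-1 by rewrite invr_ge0 ltW.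
  rewrite normrM (ger0_norm iw0) /B2.
  rewrite [in leRHS]mulrA; apply: ler_wpM2r => //; apply: le_trans (ler_normD _ _) _.
  by rewrite [in leRHS]mulrDr; apply: lerD; rewrite [in leRHS]mulrA; apply: (le_mul); rewrite ?alphaB ?betaB1 ?uM ?psiM.
have muB : `|mu| <= eps * B3.
  have XL : (1 - a) * L / b <= (L - Phi L) / b by rewrite ler_pM2r ?invr_gt0//; lra.
  have XL0 : 0 < (1 - a) * L / b by rewrite divr_gt0// mulr_gt0// subr_gt0.
  have := mean_value_bound dN (ltW L0) NB.
  have -> : N L - N 0 = - (mu * ((L - Phi L) / b)).
    by rewrite /N (periodic_end pH) uL u00 Phi0 subrr mul0r; ring.
  rewrite normrN normrM subr0 (gtr0_norm (lt_le_trans XL0 XL)) => muX.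
  rewrite -(ler_pM2r XL0); apply: (@le_trans _ _ (eps * B2 * L)).
    by apply: le_trans muX; rewrite ler_wpM2l.
  by rewrite le_eqVlt; apply/orP; left; apply/eqP; rewrite /B3; field; rewrite bN0 subr_eq0 gt_eqF.
(* The normalisation [h 0 = 0] enters here: [psi 0 = 0] and [p 0 = - mu / b], so the component along
   [u1] is controlled by [mu]. *)
have alpha0 : `|alpha 0| <= eps * (2 * M * B3).
  have -> : alpha 0 = - 2 * u1 0 * mu.
    rewrite /alpha /p /p1 h00 /psi /psi1 /chi /chi1 u00 Phi0.
    by rewrite /b /e; field; rewrite subr_eq0 gt_eqF.
  have -> : eps * (2 * M * B3) = 2 * M * (eps * B3) by ring.
  by rewrite (le_mul)//; rewrite mulNr normrN le_mul ?uM// ger0_norm.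
move=> x xL.
have -> : h x = mu * chi x + (alpha x * u1 x + beta x * psi x) / w0 by rewrite -pE /p addrC subrK.
apply: le_trans (ler_normD _ _) _; rewrite [C * eps]mulrC /C [in leRHS]mulrDr; apply: lerD.
  rewrite [in leRHS]mulrA; apply: (le_mul) => //.
  have ib0 : 0 <= b^-1 by rewrite invr_ge0 ltW.
  rewrite /chi normrM (ger0_norm ib0); apply: ler_piMl => //.
  by rewrite ler_norml; have := ua x; have := sqr_ge0 (u x); lra.
have iw0 : 0 <= w0^-1 by rewrite invr_ge0 ltW.
rewrite normrM (ger0_norm iw0) [in leRHS]mulrA.
apply: ler_wpM2r => //; apply: le_trans (ler_normD _ _) _; rewrite [in leRHS]mulrDr.
apply: lerD; rewrite [in leRHS]mulrA; apply: (le_mul); rewrite ?betaB1 ?uM ?psiM//.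
rewrite -[alpha x](subrK (alpha 0)) (le_trans (ler_normD _ _))// mulrDr.
by have := alphaB x xL; lra.
Qed.

End Nondegeneracy.

(** * Consequences of closeness in the Sobolev norm *)

Section FiniteDimension.
Variables (K : fieldType) (V : lmodType K).

Lemma has_dim0 (S : set V) : (forall h, S h <-> h = 0) -> has_dim S 0.
Proof.
move=> SE; exists (fun=> 0); split; first by move=> a _ [].
apply/seteqP; split => [h /SE ->|h [a _ <-]]; last by apply/SE; rewrite big_ord0.
by exists (fun=> 0) => //; rewrite big_ord0.
Qed.

Lemma has_dim1 (S : set V) (e : V) : e <> 0 ->
  (forall h, S h <-> exists c : K, h = c *: e) -> has_dim S 1.
Proof.
move=> e0 SE; exists (fun=> e); split=> [a|].
  rewrite big_ord1 => /eqP; rewrite scaler_eq0 => /orP[/eqP a0|/eqP//] i.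
  by rewrite ord1.
apply/seteqP; split => [h /SE [c ->]|h [a _ <-]].
  by exists (fun=> c) => //; rewrite big_ord1.
by apply/SE; exists (a ord0); rewrite big_ord1.
Qed.

End FiniteDimension.

(** * Pointwise bounds from the Sobolev norm, and two auxiliary rigidity facts *)

Section Closeness.
Context {R : realType}.
Implicit Types (f g F G u v h w : R -> R) (x y a b c d p q L delta eta : R).
Notation mu := (@lebesgue_measure R).

(** In place of Cauchy-Schwarz, [|g| <= (g^2 / eta + eta) / 2] pointwise; the primitive [T] of the
    right-hand side grows by at most [eta (1 + L)] and dominates the growth of both [G] and
    [- G]. *)
Lemma small_variation L G g eta : 0 < eta ->
  (forall x, is_derive x 1 G (g x)) -> continuous g ->
  \int[mu]_(x in `[0, L]) (g x ^+ 2) <= eta ^+ 2 ->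
  forall x y, 0 <= x -> x <= y -> y <= L -> `|G y - G x| <= eta * (1 + L).
Proof.
move=> eta0 dG cg intg x y x0 xy yL.
have cg2 : continuous (fun x => g x ^+ 2) by exact: (@Cn_exp _ 0 g 2 cg).
have [S dS] := exists_primitive cg2.
have L0 : 0 <= L by rewrite (le_trans x0) ?(le_trans xy).
have Smono s t : s <= t -> S s <= S t.
  rewrite le_eqVlt => /predU1P[->//|st]; have [c [_ _ E]] := mean_value dS st.
  by rewrite -subr_ge0 E mulr_ge0 ?sqr_ge0// subr_ge0 ltW.
have SB : S y - S x <= eta ^+ 2.
  apply: le_trans intg; rewrite (FTC2 dS cg2 L0).
  by have := Smono _ _ x0; have := Smono _ _ yL; lra.
have amgm t : `|g t| <= (g t ^+ 2 / eta + eta) / 2.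
  rewrite -(ler_pM2r eta0) -real_normK ?num_real//; set r := `|g t|.
  have -> : (r ^+ 2 / eta + eta) / 2 * eta = (r ^+ 2 + eta ^+ 2) / 2.
    by field; rewrite gt_eqF.
  by have := sqr_ge0 (r - eta); nra.
pose T t := (S t / eta + eta * t) / 2.
have dT (t : R) : is_derive t 1 T ((g t ^+ 2 / eta + eta) / 2).
  rewrite /T; have d1 := dS t.
  by eapply deriv_eq; [repeat deriv_step|rewrite /=; ring].
have key (k : R -> R) : (forall t : R, is_derive t 1 k (g t)) \/ (forall t : R, is_derive t 1 k (- g t)) ->
    k y - k x <= T y - T x.
  move=> dk; move: xy; rewrite [x <= y]le_eqVlt => /predU1P[->|ltxy]; first by rewrite !subrr.
  have [k' dk' k'B] : exists2 k' : R -> R, forall t : R, is_derive t 1 k (k' t) &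
      forall t, k' t <= (g t ^+ 2 / eta + eta) / 2.
    case: dk => dk; [exists g|exists (fun t => - g t)] => // t.
      exact: le_trans (ler_norm _) (amgm t).
    by apply: le_trans (amgm t); rewrite -normrN ler_norm.
  have dd t := deriv_add (dT t) (deriv_opp (dk' t)).
  have [c [_ _ E]] := mean_value dd ltxy.
  have : 0 <= (T y - k y) - (T x - k x).
    by rewrite E mulr_ge0 ?subr_ge0// ltW.
  by lra.
have TB : T y - T x <= eta * (1 + L).
  have -> : T y - T x = ((S y - S x) / eta + eta * (y - x)) / 2 by rewrite /T; ring.
  have h1 : (S y - S x) / eta <= eta by rewrite ler_pdivrMr// -expr2.
  have h2 : eta * (y - x) <= eta * L by rewrite ler_pM2l//; lra.
  have h3 : 0 <= eta * L by rewrite mulr_ge0// ltW.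
  by have -> : eta * (1 + L) = eta + eta * L by [ring]; lra.
have k1 := key G (or_introl dG).
have k2 := key (fun t => - G t) (or_intror (fun t => deriv_opp (dG t))).
by rewrite ler_norml; apply/andP; split; lra.
Qed.

Lemma Hnorm_ge L k f j eta : (j <= k)%N -> Hnorm L k f <= eta ->
  \int[mu]_(x in `[0, L]) (derive1n j f x ^+ 2) <= eta ^+ 2.
Proof.
move=> jk fe.
pose I (j : nat) := \int[mu]_(x in `[0, L]) (derive1n j f x ^+ 2).
have I0 i : 0 <= I i by apply: Rintegral_ge0 => x _; exact: sqr_ge0.
have S0 : 0 <= \sum_(i < k.+1) I i by apply: sumr_ge0 => i _.
apply: (@le_trans _ _ (\sum_(i < k.+1) I i)).
  by rewrite (bigD1 (Ordinal (jk : (j < k.+1)%N)))//= lerDl sumr_ge0.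
rewrite -(sqr_sqrtr S0) ler_sqr ?nnegrE ?sqrtr_ge0//.
exact: le_trans (sqrtr_ge0 _) fe.
Qed.

(** The variation of [f] is measured from its zero at [0], that of [f'] from a critical point of
    [f]. *)
Lemma Hnorm_C1_small L f eta : 0 < L -> 0 < eta -> Cn 6 f -> periodic f L -> f 0 = 0 ->
  Hnorm L 6 f <= eta ->
  (forall x, 0 <= x <= L -> `|f x| <= eta * (1 + L)) /\ `|derive1 f 0| <= eta * (1 + L).
Proof.
move=> L0 eta0 cf pf f0 fe.
have c2 := @Cn_le _ 2 6 f isT cf.
have cd1 : continuous (derive1 f) := Cn_continuous (n := 1) c2.2.
have cd2 : continuous (derive1n 2 f) := c2.2.2.
have df := Cn_derivS c2; have ddf := @Cn_derivS _ 0 (derive1 f) c2.2.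
have v0 := small_variation eta0 df cd1 (@Hnorm_ge L 6 f 1 eta isT fe).
have v1 := small_variation eta0 ddf cd2 (@Hnorm_ge L 6 f 2 eta isT fe).
split=> [x /andP[x0 xL]|]; first by have := v0 0 x (lexx 0) x0 xL; rewrite f0 subr0.
have [c /andP[c0 cL] fc] := periodic_critical L0 (periodic_end pf) df.
by have := v1 0 c (lexx 0) c0 cL; rewrite fc sub0r normrN.
Qed.

(** [critical_bound] with bound [0] descends from the fourth derivative to the first. *)
Lemma periodic_quartic_const L F : 0 < L -> Cn 4 F -> periodic F L ->
  (forall x, derive1n 4 F x = 0) -> forall x, F x = F 0.
Proof.
move=> L0 cF pF E.
have per j : (j <= 4)%N -> derive1n j F L = derive1n j F 0.
  by move=> j4; exact: periodic_end (derive1n_periodic cF pF j4).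
have d0 := @Cn_deriv _ 4 0 F cF isT; have d1 := @Cn_deriv _ 4 1 F cF isT.
have d2 := @Cn_deriv _ 4 2 F cF isT; have d3 := @Cn_deriv _ 4 3 F cF isT.
have B4 x : 0 <= x <= L -> `|derive1n 4 F x| <= 0 by rewrite E normr0.
have B3 := critical_bound L0 (per 2%N isT) d2 d3 B4.
have B2 := critical_bound L0 (per 1%N isT) d1 d2 B3.
have B1 := critical_bound L0 (per 0%N isT) d0 d1 B2.
move=> x; have [y /andP[y0 yL] ->//] := periodic_repr x L0.
have /(_ (0 * L * L * L)) := mean_value_bound d0 y0.
rewrite !mul0r normr_le0 subr_eq0 => H; apply/eqP; apply: H => z /andP[z0 zy].
by have := B1 z; rewrite !mul0r; apply; rewrite z0 (le_trans zy (ltW yL)).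
Qed.

(** After reduction modulo [2 pi], [cos y = 1 - 2 sin^2 (y / 2)] and the sine is positive on []0,
    pi[]. *)
Lemma cos_eq1 x : 0 < x -> cos x = 1 -> exists2 k, (1 <= k)%N & 2 * k%:R * pi = x.
Proof.
move=> x0 cx.
have pi2 : 0 < (2 * pi : R) by rewrite mulr_gt0// pi_gt0.
have /truncn_itv : 0 <= x / (2 * pi) by rewrite divr_ge0// ltW.
set k := Num.truncn _; rewrite ler_pdivlMr// ltr_pdivrMr// => /andP[k1 k2].
pose y := x - k%:R * (2 * pi).
have y0 : 0 <= y by rewrite subr_ge0.
have y2 : y < 2 * pi by move: k2; rewrite -natr1 /y; lra.
have cy : cos y = 1.
  rewrite -cx -[in RHS](subrK (k%:R * (2 * pi)) x) -/y.
  by rewrite -(periodicn (@cosD2pi R) k y); congr cos; rewrite -[_ *+ k]mulr_natl -[pi *+ 2]mulr_natl.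
have y00 : y = 0.
  apply/eqP; rewrite eq_le y0 andbT leNgt; apply/negP => ygt0.
  have : 0 < sin (y / 2) by apply: sin_gt0_pi; apply/andP; split; lra.
  have : cos y = cos (y / 2) ^+ 2 - sin (y / 2) ^+ 2.
    by rewrite [in LHS](splitr y) cosD !expr2.
  by rewrite cy cos2sin2; have := sqr_ge0 (sin (y / 2)); nra.
have xE : 2 * k%:R * pi = x by move: y00; rewrite /y; lra.
exists k => //; rewrite lt0n; apply/eqP => k00.
by move: x0; rewrite -xE k00 mulr0 mul0r ltxx.
Qed.

End Closeness.

(** * The kernel near a steady state *)

Section Kernel.
Context {R : realType}.
Implicit Types (f g F G u v h w : R -> R) (x y a b c d p q L delta eta : R).
Notation mu := (@lebesgue_measure R).

(** At the zero state the [delta] term vanishes, so the estimate with bound [0] gives [h'' + h = k];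
    integrating over a period gives [k = 0]. Then [(h, h')] rotates by the angle [L] over a period,
    and periodicity forces it to vanish unless [cos L = 1]. *)
Lemma ker_lin_zero L delta h : 0 < L -> ~ (exists2 k, (1 <= k)%N & 2 * k%:R * pi = L) ->
  ker_lin L delta (fun=> 0) h -> h = fun=> 0.
Proof.
move=> L0 LN kh; have [ch [H pH dH] _] := kh.
have ph : periodic h L := periodic_deriv pH dH.
have [k hk] : exists k, forall x, 0 <= x <= L ->
    `|flux (fun=> 0) h x - k| <= 2 * `|delta| * 0 * L ^+ 3.
  apply: (ker_lin_estimate L0 (Cn_cst 5 0)) kh _ => // x.
  by rewrite mul0r normr0.
have dh := Cn_derivS ch; have ddh := @Cn_derivS _ 4 (derive1 h) ch.2.
have ph1 := periodic_deriv ph dh; have ph2 := periodic_deriv ph1 ddh.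
have h2E x : derive1 (derive1 h) x = k - h x.
  have [y /andP[y0 yL] xy] := periodic_repr x L0; rewrite (xy _ ph2) (xy _ ph).
  have := hk y; rewrite y0 (ltW yL) mulr0 mul0r normr_le0 subr_eq0 => /(_ isT) /eqP <-.
  rewrite /flux -[derive1n 2 h y]/(derive1 (derive1 h) y).
  by move: (derive1 (derive1 h) y) => z; ring.
have k0 : k = 0.
  have dE x : is_derive x 1 (fun y => derive1 h y + H y - k * y) 0.
    apply: deriv_eq (deriv_add (deriv_add (ddh x) (dH x)) (deriv_opp (deriv_mul (deriv_cst k x) (deriv_id x)))) _.
    by rewrite h2E; ring.
  have := deriv0_const dE L 0; rewrite (periodic_end ph1) (periodic_end pH) mulr0.
  move=> /eqP; rewrite -subr_eq0; move: (derive1 h 0 + H 0) => z.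
  rewrite (_ : z - k * L - (z - 0) = - (k * L)); last by ring.
  by rewrite oppr_eq0 mulf_eq0 (gt_eqF L0) orbF => /eqP.
pose A x := h x * cos x - derive1 h x * sin x.
pose B x := h x * sin x + derive1 h x * cos x.
have dA x : is_derive x 1 A 0.
  apply: deriv_eq (deriv_add (deriv_mul (dh x) (is_derive_cos x)) (deriv_opp (deriv_mul (ddh x) (is_derive_sin x)))) _.
  by rewrite h2E k0; ring.
have dB x : is_derive x 1 B 0.
  apply: deriv_eq (deriv_add (deriv_mul (dh x) (is_derive_sin x)) (deriv_mul (ddh x) (is_derive_cos x))) _.
  by rewrite h2E k0; ring.
have AL := deriv0_const dA L 0; have BL := deriv0_const dB L 0.
move: AL BL; rewrite /A /B sin0 cos0 !mulr1 !mulr0 subr0 add0r.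
rewrite (periodic_end ph) (periodic_end ph1).
set p := h 0; set q := derive1 h 0 => AL BL.
(* The scalar product of [(p, q)] with its rotated copy, which equals it. *)
have pq : (p ^+ 2 + q ^+ 2) * (1 - cos L) = 0.
  rewrite mulrBr mulr1; apply/eqP; rewrite subr_eq0; apply/eqP.
  transitivity (p * (p * cos L - q * sin L) + q * (p * sin L + q * cos L)); last by ring.
  by rewrite AL BL; ring.
have cosL : 1 - cos L != 0.
  by rewrite subr_eq0 eq_sym; apply/eqP => /(cos_eq1 L0).
move/eqP: pq; rewrite mulf_eq0 (negbTE cosL) orbF paddr_eq0 ?sqr_ge0// !sqrf_eq0.
move=> /andP[/eqP p0 /eqP q0]; apply/funext => x.
have Ax : A x = 0 by rewrite (deriv0_const dA x 0) /A -/p -/q p0 q0; ring.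
have Bx : B x = 0 by rewrite (deriv0_const dB x 0) /B -/p -/q p0 q0; ring.
have -> : h x = A x * cos x + B x * sin x.
  transitivity (h x * (cos x ^+ 2 + sin x ^+ 2)); last by rewrite /A /B; ring.
  by rewrite cos2Dsin2 mulr1.
by rewrite Ax Bx; ring.
Qed.

Lemma kernel_simple L u : 0 < L -> nonconst_steady0 L u -> u 0 = 0 ->
  exists eta d, [/\ 0 < eta, 0 < d & forall delta v, `|delta| < d -> steady L delta v ->
    v 0 = 0 -> Hnorm L 6 (fun x => v x - u x) <= eta ->
    derive1 v 0 != 0 /\ forall h, ker_lin L delta v h ->
      exists c, h = fun x => c * derive1 v x].
Proof.
move=> L0 [ncu su] u00.
have [c7 zu E] := steady_classical L0 su.
have pu := zero_mean_periodic zu; have [U pU dU] := zu.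
have du := Cn_derivS c7; have ddu := @Cn_derivS _ 5 (derive1 u) c7.2.
have c5 : Cn 5 u := @Cn_le _ 5 7 u isT c7.
have [c1 c1E] : exists c1, forall x, derive1 (derive1 u) x = u x ^+ 3 - u x + c1.
  pose F y := derive1n 2 u y - (u y ^+ 3 - u y).
  have cF : Cn 4 F.
    apply: Cn_pred; exact: (Cn_add (@Cn_derive1n _ 5 2 u c7) (Cn_opp (Cn_add (Cn_exp 3 c5) (Cn_opp c5)))).
  have pF : periodic F L.
    by move=> x; rewrite /F (derive1n_periodic c7 pu (isT : (2 <= 7)%N)) pu.
  have E4 x : derive1n 4 F x = 0.
    by rewrite -[RHS](E x) steady_opE mul0r mul0r add0r.
  exists (F 0) => x; rewrite -(periodic_quartic_const L0 cF pF E4 x) /F.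
  by rewrite -[derive1n 2 u x]/(derive1 (derive1 u) x) subrKC.
have ddu1 x : is_derive x 1 (derive1 u) (u x ^+ 3 - u x + c1) by rewrite -c1E.
have [c10 [a [a0 a1 ua en]]] := steady_amplitude L0 pu du ddu1 pU dU ncu.
have {ddu1}ddu1 x : is_derive x 1 (derive1 u) (u x ^+ 3 - u x).
  by apply: deriv_eq (ddu1 x) _; rewrite c10 addr0.
have [C C0 nd] := nondegenerate L0 pu u00 du ddu1 a0 a1 ua en.
have u1N0 : 0 < `|derive1 u 0|.
  rewrite normr_gt0 -sqrf_eq0 en u00 expr0n /= !subr0 gt_eqF// !mulr_gt0//.
  by lra.
(* The three bounds give [|v| <= 2], a nonzero [derive1 v 0], and [9 C rho <= 1 / 4]. *)
pose rho := Num.min 1 (Num.min (`|derive1 u 0| / 2) (36 * C)^-1).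
have rho0 : 0 < rho.
  by rewrite !lt_min ltr01 divr_gt0//= invr_gt0 mulr_gt0.
have [rho1 rho2 rho3] : [/\ rho <= 1, rho <= `|derive1 u 0| / 2 & rho <= (36 * C)^-1].
  by split; rewrite /rho !ge_min lexx ?orbT.
have L1 : 0 < 1 + L by rewrite addr_gt0.
have L30 : 0 < L ^+ 3 by rewrite exprn_gt0.
(* [Hnorm_C1_small] loses a factor [1 + L]; the threshold for [delta] makes
   [4 C |delta| L^3 <= 1 / 4]. *)
exists (rho / (1 + L)), (16 * C * L ^+ 3)^-1; split.
- by rewrite divr_gt0.
- by rewrite invr_gt0 !mulr_gt0.
move=> delta v dd sv v00 vu.
have [c7v zv Ev] := steady_classical L0 sv.
have pv := zero_mean_periodic zv.
have c5v : Cn 5 v := @Cn_le _ 5 7 v isT c7v.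
have c6w : Cn 6 (fun x => v x - u x).
  by apply: Cn_pred; exact: Cn_add c7v (Cn_opp c7).
have pw : periodic (fun x => v x - u x) L by move=> x; rewrite pv pu.
have eta0 : 0 < rho / (1 + L) by rewrite divr_gt0.
have w00 : v 0 - u 0 = 0 by rewrite v00 u00 subrr.
have [vuB vu1] := Hnorm_C1_small L0 eta0 c6w pw w00 vu.
have {vuB}vuB x : 0 <= x <= L -> `|v x - u x| <= rho.
  by move=> /vuB; rewrite divfK// gt_eqF.
have dv := Cn_derivS c7v.
have {vu1}vu1 : `|derive1 v 0 - derive1 u 0| <= rho.
  move: vu1; rewrite divfK ?gt_eqF//.
  by rewrite (derive1_deriv (deriv_add (dv 0) (deriv_opp (du 0)))).
have v1N0 : derive1 v 0 != 0.
  apply/eqP => v10; move: vu1; rewrite v10 sub0r normrN.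
  by move: (`|derive1 u 0|) u1N0 rho2 => t t0 h1 h2; lra.
split=> // h kh.
have kv := ker_lin_derive1 c7v zv Ev.
pose c := h 0 / derive1 v 0; exists c.
pose g x := h x - c * derive1 v x.
have kg : ker_lin L delta v g := ker_lin_sub c c5v kh kv.
have g00 : g 0 = 0 by rewrite /g /c divfK// subrr.
suff g0 : forall x, g x = 0.
  by apply/funext => x; apply/eqP; rewrite -subr_eq0; apply/eqP; exact: g0.
have [cg [G pG dG] _] := kg.
have pg : periodic g L := periodic_deriv pG dG.
have dg := Cn_derivS cg; have ddg := @Cn_derivS _ 4 (derive1 g) cg.2.
have cng : continuous (fun x => `|g x|).
  move=> x; apply: continuous_comp; last exact: norm_continuous.
  exact: (Cn_continuous cg).
have [s s0L smax] := EVT_max (ltW L0) (continuous_subspaceT cng).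
pose S := `|g s|.
have {smax}gS x : 0 <= x <= L -> `|g x| <= S.
  by move=> xL; apply: smax; rewrite in_itv/=.
have S0 : 0 <= S := normr_ge0 _.
have uB x : `|u x| <= 1.
  by rewrite -(expr_le1 (n := 2))// real_normK ?num_real// (le_trans (ua x))// ltW.
have vB x : 0 <= x <= L -> `|v x| <= 2.
  move=> xL; rewrite -[v x](subrK (u x)) (le_trans (ler_normD _ _))//.
  by have := vuB x xL; have := uB x; lra.
have vgB x : `|v x * g x| <= 2 * S.
  have [y /andP[y0 yL] xy] := periodic_repr x L0; rewrite (xy _ pv) (xy _ pg) normrM.
  by apply: ler_pM => //; [apply: vB|apply: gS]; rewrite y0 ltW.
have [k kE] := ker_lin_estimate L0 c5v pv kg vgB.
(* The first term is [ker_lin_estimate] with bound [2 S]; the second is [3 (v + u) (v - u) g], with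
   [|v| <= 2] and [|u| <= 1]. *)
have key x : 0 <= x <= L ->
    `|derive1 (derive1 g) x - (3 * u x ^+ 2 - 1) * g x - k| <= 4 * `|delta| * S * L ^+ 3 + 9 * rho * S.
  move=> xL.
  have -> : derive1 (derive1 g) x - (3 * u x ^+ 2 - 1) * g x - k =
      (flux v g x - k) + (3 * (v x + u x)) * (v x - u x) * g x.
    rewrite /flux -[derive1n 2 g x]/(derive1 (derive1 g) x).
    by move: (derive1 (derive1 g) x) (g x) => z z'; ring.
  apply: le_trans (ler_normD _ _) _; apply: lerD.
    by apply: le_trans (kE x xL) _; rewrite le_eqVlt; apply/orP; left; apply/eqP; ring.
  rewrite !normrM; apply: ler_pM; rewrite ?mulr_ge0//; last exact: gS.
  apply: ler_pM; rewrite ?mulr_ge0//; last exact: vuB.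
  rewrite ger0_norm//; have := ler_normD (v x) (u x); have := vB x xL; have := uB x.
  by move: (`|v x|) (`|u x|) (`|v x + u x|) => z1 z2 z3; lra.
have := nd g (derive1 g) (fun x => derive1 (derive1 g) x) G k _ dg ddg pG dG g00 key s.
rewrite -/S => Ss.
have {Ss}Ss : S <= C * (4 * `|delta| * S * L ^+ 3 + 9 * rho * S).
  by apply: Ss; move: s0L; rewrite in_itv.
have small1 : C * (4 * `|delta| * L ^+ 3) <= 4^-1.
  have CL : 0 < 16 * C * L ^+ 3 by rewrite !mulr_gt0.
  have : `|delta| * (16 * C * L ^+ 3) <= 1 by rewrite -ler_pdivlMr// div1r ltW.
  by move: (`|delta|) (L ^+ 3) => z1 z2; lra.
have small2 : C * (9 * rho) <= 4^-1.
  have C36 : 0 < 36 * C by rewrite mulr_gt0.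
  have : rho * (36 * C) <= 1 by rewrite -ler_pdivlMr// div1r.
  by lra.
have SS : S <= 2^-1 * S.
  apply: le_trans Ss _.
  have -> : C * (4 * `|delta| * S * L ^+ 3 + 9 * rho * S) =
    (C * (4 * `|delta| * L ^+ 3) + C * (9 * rho)) * S by ring.
  by apply: ler_wpM2r => //; lra.
have S00 : S = 0 by lra.
move=> x; have [y /andP[y0 yL] ->//] := periodic_repr x L0.
by apply/eqP; rewrite -normr_le0 -S00; apply: gS; rewrite y0 ltW.
Qed.

End Kernel.

(** * Transport along a translation orbit, and the choice of [delta1] *)

Lemma Efam_has_dim1 (R : realType) (L delta : R) (v : R -> R) (s : R) :
  0 < L -> steady L delta v -> derive1 v 0 != 0 ->
  (forall h, ker_lin L delta v h -> exists c, h = fun x => c * derive1 v x) ->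
  has_dim (eigenspace_lin L delta (shift_by s v) 0) 1.
Proof.
move=> L0 sv v1 simple.
have [c7 zv E] := steady_classical L0 sv.
have kv := ker_lin_derive1 c7 zv E.
have c5 : Cn 5 (shift_by s v) := Cn_shift s (@Cn_le _ 5 7 v isT c7).
have pv := periodic_shift s (zero_mean_periodic zv).
apply: (@has_dim1 _ _ _ (shift_by s (derive1 v) : R -> R^o)) => [e0|h].
  move/eqP: v1; apply; have := congr1 (fun f : R -> R => f (- s)) e0.
  by rewrite /shift_by addNr.
rewrite (eigenspace_linE delta h L0 c5 pv); split=> [kh|[c ->]].
  have := ker_lin_shift (- s) kh.
  have -> : shift_by (- s) (shift_by s v) = v.
    by apply/funext => x; rewrite /shift_by subrK.
  move=> /simple [c hc]; exists c; apply/funext => x.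
  have := congr1 (fun f : R -> R => f (x + s)) hc.
  by rewrite /shift_by addrK.
suff kcv : ker_lin L delta v (fun x => c * derive1 v x).
  have -> : c *: (shift_by s (derive1 v) : R -> R^o) = shift_by s (fun x => c * derive1 v x).
    by apply/funext.
  by have := ker_lin_shift s kcv.
(* Written as a difference so that [ker_lin_sub] also provides closure under scaling. *)
have -> : (fun x => c * derive1 v x) = (fun x => derive1 v x - (1 - c) * derive1 v x).
  by apply/funext => x; move: (derive1 v x) => z; ring.
exact: (ker_lin_sub (1 - c) (@Cn_le _ 5 7 v isT c7) kv kv).
Qed.

Unset Implicit Arguments.
Set Strict Implicit.

Theorem lemma2p23 (R : realType) (L0 : R) (hL0 : is_L0 L0)
    (L : R) (hL : L0 <= L) (hLE : ~ @Eset R L)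
    (n : nat) (u : 'I_n -> R -> R) (hu : orbit_representatives L u)
    (hu0 : forall i, u i 0 = 0 /\ u i L = 0)
    (delta0 : R) (U : 'I_n -> R -> R -> R)
    (hU : continuation_families L u delta0 U) :
  exists delta1 : R, [/\ 0 < delta1, delta1 <= delta0 &
    forall delta : R, `|delta| < delta1 ->
      (forall (i : 'I_n) (ustar : R -> R), Efam L U delta i ustar ->
         has_dim (eigenspace_lin L delta ustar 0) 1) /\
      (forall ustar : R -> R, @Efam0 R ustar ->
         has_dim (eigenspace_lin L delta ustar 0) 0)].
Proof.
have L_gt0 : 0 < L by case: hL0 => L00 _ _; exact: lt_le_trans hL.
case: hU => delta0_gt0 Ucurve _ Usteady [C UC]; case: hu => us _ _.
pose simple i (delta : R) := derive1 (U i delta) 0 != 0 /\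
    forall h, ker_lin L delta (U i delta) h ->
      exists c, h = fun x => c * derive1 (U i delta) x.
have near_simple i : \forall delta \near (0 : R), simple i delta.
  have [eta [d [eta0 d0 H]]] := kernel_simple L_gt0 (us i) (hu0 i).1.
  (* [C] may have any sign; [|C| + 1] is a positive upper bound by which [eta] can be divided. *)
  have C1 : 0 < `|C| + 1 by rewrite ltr_wpDl.
  have small e : 0 < e -> \forall delta \near (0 : R), `|delta| < e.
    move=> e0; apply/nbhs_ballP; exists e => //= t.
    by rewrite /ball/= sub0r normrN.
  near=> delta.
  have dd0 : `|delta| < delta0 by near: delta; exact: small.
  have deta : `|delta| < eta / (`|C| + 1) by near: delta; apply: small; exact: divr_gt0.
  apply: H; [by near: delta; exact: small|exact: Usteady| |].
    by case: (Ucurve i) => /(_ delta dd0)[].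
  apply: le_trans (UC i _ dd0) _; move: deta; rewrite ltr_pdivlMr// => /ltW.
  apply: le_trans; rewrite mulrC; apply: ler_wpM2l => //.
  by have := ler_norm C; lra.
(* The index set is finite, so one neighbourhood of [0] serves all families. *)
have : \forall delta \near (0 : R), forall i, simple i delta := filter_forall _ near_simple.
move=> [r /= r0 Hr].
exists (Num.min r delta0); split.
- by rewrite lt_min r0.
- by rewrite ge_min lexx orbT.
move=> delta; rewrite lt_min => /andP[dr dd0]; split=> [i ustar [s _ <-]|ustar ->].
  have [|v1 simplei] := Hr delta _ i; first by rewrite /ball/= sub0r normrN.
  exact: Efam_has_dim1 (Usteady i _ dd0) v1 simplei.
have p0 : periodic (fun=> 0 : R) L by [].
apply: has_dim0 => h; rewrite (eigenspace_linE delta h L_gt0 (Cn_cst 5 0) p0).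
(* The multiples of [2 pi] belong to [Eset], which excludes resonance at the zero state. *)
have noE : ~ (exists2 k, (1 <= k)%N & 2 * k%:R * pi = L) by move=> kL; apply: hLE; right.
split=> [/(ker_lin_zero L_gt0 noE)//|->].
have c0 : Cn 6 (fun=> 0 : R) := Cn_cst 6 0.
have d0 k : derive1n k (fun=> 0 : R) = fun=> 0.
  by elim: k => [//|k IH]; rewrite derive1nS IH; apply/funext => x; exact: derive1_cst.
split; [exact: c0|by exists (fun=> 0 : R) => // x; exact: deriv_cst|move=> x].
have e1 : flux (fun=> 0) (fun=> 0 : R) = fun=> 0.
  by apply/funext => y; rewrite /flux d0 mulr0 subr0.
have e2 : (fun y : R => 0 * 0 : R) = fun=> 0 by apply/funext => y; rewrite mulr0.
by rewrite lin_opE e1 e2 d0 derive1_cst mulr0 addr0.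
Unshelve. all: by end_near. Qed.
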